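(* Let $\mu=(\mu_I)_{I\in\mathcal{D}^4}$ be a balanced non-negative sequence with the packing condition $$\frac1{|I|}\sum_{J\in\mathcal{D}^4(I)}\mu_J\leqslant C(\mu)\qquad\text{for all } I\in\mathcal{D}^4,$$ where $C(\mu)<\infty$ is a constant. Then there holds the embedding from $H^2_{\mathrm{dy}}$ to $\ell^2(\mu)$: for all $f=u+iv\in H^2_{\mathrm{dy}}$, $$\sum_{I\in\mathcal{D}^4}\mu_I\,(u_I^2+v_I^2)\leqslant e\,C(\mu)\,\|f\|^2_{H^2_{\mathrm{dy}}} .$$ Moreover the constant $e$ is sharp: for every $c<e$ there exist a balanced non-negative sequence $\mu$ satisfying the packing condition with some finite constant $C(\mu)$ and $f=u+iv\in H^2_{\mathrm{dy}}$ such that $\sum_{I\in\mathcal{D}^4}\mu_I(u_I^2+v_I^2)>c\,C(\mu)\|f\|^2_{H^2_{\mathrm{dy}}}$.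
   Context: Let $I_0=[0,1)$ and let $\mathcal{D}^4=\mathcal{D}^4(I_0)=\{[n4^{-k},(n+1)4^{-k}) : k\in\mathbb{N}_0,\ 0\leqslant n\leqslant 4^k-1\}$ be the 4-adic intervals. For a dyadic interval $K\subseteq I_0$ write $\mathcal{D}^4(K)=\{J\in\mathcal{D}^4: J\subseteq K\}$. For an interval $I$ write $I_-$ and $I_+$ for its left and right halves. For $I\in\mathcal{D}^4$ set $I^y=I_-$ and $I^x=I_+$, and let $I^\star_-$, $I^\star_+$ be the left and right halves of $I^\star$, $\star\in\{x,y\}$; these are the four 4-adic children of $I$, each of length $|I|/4$. A real family $u=(u_I)_{I\in\mathcal{D}^4}$ is a sliced dyadic martingale if for all $I\in\mathcal{D}^4$ $$u_I=\frac{u_{I^x_+}+u_{I^x_-}}2=\frac{u_{I^y_+}+u_{I^y_-}}2 .$$ Its increments are $\Delta^\star u_I=\frac12(u_{I^\star_+}-u_{I^\star_-})$, $\star\in\{x,y\}$. If it is $L^2$ integrable, i.e. $\sup_n\sum_{I\in\mathcal{D}^4,|I|=4^{-n}}|I|u_I^2<\infty$, then it is identified with its $L^2$ limit $u\in L^2(I_0)$, so that $u_I=\langle u\rangle_I$ is the average of $u$ over $I$. The dyadic Hardy space $H^2_{\mathrm{dy}}$ consists of $f=u+iv$ with $u,v$ real-valued $L^2$ integrable sliced dyadic martingales satisfying the dyadic Cauchy–Riemann equations $\Delta^x u_I=\Delta^y v_I$, $\Delta^y u_I=-\Delta^x v_I$ for all $I\in\mathcal{D}^4$. Its norm is $\|f\|^2_{H^2_{\mathrm{dy}}}=\int_{I_0}(u^2+v^2)$.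 A sequence $(\mu_I)_{I\in\mathcal{D}^4}$ is balanced if for all $I\in\mathcal{D}^4$ $$\frac1{|I^x|}\sum_{J\in\mathcal{D}^4(I^x)}\mu_J=\frac1{|I^y|}\sum_{J\in\mathcal{D}^4(I^y)}\mu_J=\frac1{|I|}\sum_{J\in\mathcal{D}^4(I)}\mu_J-\frac{\mu_I}{|I|} .$$ *)

(* Defs.v *)
From HB Require Import structures.
From mathcomp Require Import all_boot all_order all_algebra.
From mathcomp Require Import all_classical all_reals all_analysis.
From mathcomp Require Import ring zify.

Set Implicit Arguments.
Unset Strict Implicit.
Unset Printing Implicit Defensive.

Import Order.TTheory GRing.Theory Num.Theory.
Import numFieldNormedType.Exports.
Local Open Scope classical_set_scope.
Local Open Scope ring_scope.

(* The pair (k, n) with n < 4 ^ k stands for [n 4^-k, (n + 1) 4^-k); distinct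
   pairs give distinct intervals, so a family over the 4-adic intervals is a
   function on this type. *)
Notation D4 := {k : nat & 'I_(4 ^ k)%N}.

Definition cell (k : nat) (n : 'I_(4 ^ k)%N) : D4 := existT _ k n.

Variant slice := Sx | Sy.

Definition is_x (s : slice) : bool := if s is Sx then true else false.

Lemma child_subproof (k n : nat) (a b : bool) :
  (n < 4 ^ k -> 4 * n + 2 * a + b < 4 ^ k.+1)%N.
Proof.
by rewrite expnS; case: a; case: b => /=; lia.
Qed.

(* [child s b I] is the right (b = true) or left (b = false) half of I^x
   (s = Sx) or I^y (s = Sy); I^y is the left and I^x the right half of I. *)
Definition child (s : slice) (b : bool) (I : D4) : D4 :=
  cell (Ordinal (child_subproof (is_x s) b (ltn_ord (projT2 I)))).

Section Intervals.
Variable R : realType.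

Definition len (I : D4) : R := (4 ^+ projT1 I)^-1.

Definition lo (I : D4) : R := (projT2 I)%:R * len I.

Definition itv4 (I : D4) : set R := [set` `[lo I, lo I + len I[].

Definition half (s : slice) (I : D4) : set R :=
  if s is Sx then [set` `[lo I + len I / 2, lo I + len I[]
  else [set` `[lo I, lo I + len I / 2[].

Definition D4_in (K : set R) : set D4 := [set J | itv4 J `<=` K].

Lemma len_child (s : slice) (b : bool) (I : D4) :
  len (child s b I) = len I / 4.
Proof. by rewrite /len /= exprS invfM mulrC. Qed.

Lemma lo_child (s : slice) (b : bool) (I : D4) :
  lo (child s b I) = lo I + (is_x s)%:R * (len I / 2) + b%:R * (len I / 4).
Proof.
by rewrite {1}/lo len_child /lo /= !natrD; field.
Qed.

End Intervals.

Arguments itv4 R I : clear implicits.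
Arguments half R s I : clear implicits.

Section Martingales.
Variable R : realType.
Implicit Types u v : D4 -> R.

Definition sliced_martingale u : Prop :=
  forall I : D4,
    u I = (u (child Sx true I) + u (child Sx false I)) / 2 /\
    u I = (u (child Sy true I) + u (child Sy false I)) / 2.

Definition Delta (s : slice) u (I : D4) : R :=
  2^-1 * (u (child s true I) - u (child s false I)).

Definition L2_integrable u : Prop :=
  exists M : R, forall n : nat,
    \sum_(i < (4 ^ n)%N) len R (cell i) * u (cell i) ^+ 2 <= M.

Definition I0 : set R := [set` `[0, 1[].

Definition step u (n : nat) (x : R) : R :=
  \sum_(i < (4 ^ n)%N) u (cell i) * \1_(itv4 R (cell i)) x.

Definition is_L2_limit u (U : R -> R) : Prop :=
  [/\ measurable_fun I0 U,
      lebesgue_measure.-integrable I0 (fun x => (U x ^+ 2)%:E) &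
      (\int[lebesgue_measure]_(x in I0) ((step u n x - U x) ^+ 2)%:E)%E
        @[n --> \oo] --> 0%E].

(* A choice of representative; any two L^2 limits agree almost everywhere
   on [0, 1). *)
Definition L2_limit u : R -> R := xget (fun=> 0) [set U | is_L2_limit u U].

Definition cauchy_riemann u v : Prop :=
  forall I : D4,
    Delta Sx u I = Delta Sy v I /\ Delta Sy u I = - Delta Sx v I.

(* The function f = u + iv is represented by the pair (u, v). *)
Definition hardy u v : Prop :=
  [/\ sliced_martingale u /\ L2_integrable u,
      sliced_martingale v /\ L2_integrable v &
      cauchy_riemann u v].

Definition hardy_norm_sq u v : \bar R :=
  (\int[lebesgue_measure]_(x in I0)
     (L2_limit u x ^+ 2 + L2_limit v x ^+ 2)%:E)%E.

End Martingales.

Section Sequences.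
Variable R : realType.
Implicit Type mu : D4 -> R.

(* [\esum] is a supremum of finite partial sums, so the two conditions below
   are meant for non-negative [mu] only. *)
Definition balanced mu : Prop :=
  forall (I : D4) (s : slice),
    ((len R I / 2)^-1%:E * (\esum_(J in D4_in (half R s I)) (mu J)%:E) =
     (len R I)^-1%:E * (\esum_(J in D4_in (itv4 R I)) (mu J)%:E)
       - (mu I / len R I)%:E)%E.

Definition packing mu (C : R) : Prop :=
  forall I : D4,
    ((len R I)^-1%:E * (\esum_(J in D4_in (itv4 R I)) (mu J)%:E) <= C%:E)%E.

End Sequences.

(* Main.v *)
Require Import Defs.
From HB Require Import structures.
From mathcomp Require Import all_boot all_order all_algebra.
From mathcomp Require Import all_classical all_reals all_analysis.
From mathcomp Require Import measurable_realfun.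
From mathcomp Require Import ring lra zify.

Set Implicit Arguments.
Unset Strict Implicit.
Unset Printing Implicit Defensive.

Import Order.TTheory GRing.Theory Num.Theory.
Import numFieldNormedType.Exports.
Local Open Scope classical_set_scope.
Local Open Scope ring_scope.

(** Write f = u + iv, and let A_I be the normalized mass of the sequence under I
    and m_I = mu_I / |I|.  Being balanced means exactly that A_I = m_I + the
    average of A over the two children of I in either slice, so A is a
    potential with values in [0, C].

    Upper bound.  Consider B_I = |f_I|^2 exp (- A_I / C), the dyadic form of
    the subharmonic weight |f|^2 e^phi.  Passing from I to its four children
    takes two moves.  Lowering A_I by m_I multiplies B_I by
    exp (m_I / C) >= 1 + m_I / C, a gain of at least m_I |f_I|^2 / (e C) because
    A_I <= C.  Then, by the Cauchy-Riemann equations, f moves to f + d, f - d,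
    f + id, f - id while the potential moves by +-a in one slice and +-b in the
    other; the average of B does not decrease ([weighted_children_ge]), as the
    quadratic form in (f, d) that comes up is nonnegative precisely because
    (cosh a - 1) (cosh b - 1) >= 0.  Summing over the levels, the partial sums
    of mu_I |f_I|^2 are at most e C times the average of |f_I|^2 over a level
    ([carleson_sum_le]), which is at most the squared norm.

    The norm.  It is defined through a chosen L^2 limit, so such a limit must be
    produced.  The increments of a sliced martingale are orthogonal, so the
    squared L^2 distance of two levels is the difference of their energies; a
    subsequence with rapidly converging energies converges almost everywhere,
    and Fatou's lemma makes its pointwise limit an L^2 limit
    ([L2_limit_exists]).  For any L^2 limit the energies increase to its squared
    norm ([L2_limit_energy]).

    Sharpness.  Equality in the second move holds when b = 0 and
    d = f tanh (a / 2).  Take C = 1, delta = 1 / N, and let the potential perform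
    a lazy random walk on {0, delta, ..., 1} with steps delta, starting from 1,
    absorbed at 0, and pushed down from 1 to 1 - delta by a mass m_I = delta; f
    follows with d = f tanh (delta / 2).  The only losses are then
    exp (delta) - 1 against delta in the first move, the starting value of B, and
    the part of |f|^2 that has not yet been absorbed at a given level n, where
    the process is stopped and the remaining potential is put into mu.  The first
    is negligible for large N.  So is the second, as the average of B (1 + N A)
    does not decrease, so that the absorbed part of B eventually is about N times
    its initial value ([total_height]).  The third decays geometrically in n,
    which is seen with a strictly superharmonic function of the walk
    ([transition_barrier]). *)

(** * Nesting of 4-adic intervals *)

Section Nesting.
Variable R : realType.
Implicit Types I J : D4.

Lemma len_gt0 I : 0 < len R I.
Proof. by rewrite /len invr_gt0 exprn_gt0. Qed.

(** All inclusions below compare 4-adic intervals with grid intervals; this turns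
    them into inequalities between natural numbers. *)
Lemma itv4_subset J k (a b : nat) :
  itv4 R J `<=` [set` `[a%:R / 4 ^+ k, b%:R / 4 ^+ k[] <->
  (a * 4 ^ projT1 J <= projT2 J * 4 ^ k)%N /\
  ((projT2 J).+1 * 4 ^ k <= b * 4 ^ projT1 J)%N.
Proof.
have Jgt := len_gt0 J.
have p4 (m : nat) : 0 < 4 ^+ m :> R by rewrite exprn_gt0.
have endE : lo R J + len R J = (projT2 J).+1%:R / 4 ^+ projT1 J.
  by rewrite /lo /len -(natr1 (projT2 J)); ring.
have loE : lo R J = (projT2 J)%:R / 4 ^+ projT1 J by [].
have le1 : (a%:R / 4 ^+ k <= lo R J) = (a * 4 ^ projT1 J <= projT2 J * 4 ^ k)%N.
  by rewrite loE ler_pdivrMr// mulrAC ler_pdivlMr// -(ler_nat R) !natrM !natrX.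
have le2 : (lo R J + len R J <= b%:R / 4 ^+ k) =
    ((projT2 J).+1 * 4 ^ k <= b * 4 ^ projT1 J)%N.
  by rewrite endE ler_pdivrMr// mulrAC ler_pdivlMr// -(ler_nat R) !natrM !natrX.
rewrite -le1 -le2; split.
  move=> sub; split.
    have /sub : itv4 R J (lo R J) by rewrite /itv4/= in_itv/= lexx ltrDl.
    by rewrite /= in_itv/= => /andP[].
  rewrite leNgt; apply/negP => ltb.
  have : itv4 R J (Num.max (lo R J) (b%:R / 4 ^+ k)).
    by rewrite /itv4/= in_itv/= le_max lexx/= gt_max ltrDl Jgt.
  by move=> /sub; rewrite /= in_itv/= => /andP[_]; rewrite gt_max ltxx andbF.
move=> [h1 h2] x; rewrite /itv4/= !in_itv/= => /andP[x1 x2].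
by rewrite (le_trans h1 x1) (lt_le_trans x2 h2).
Qed.

(** Powers of 4 divide one another; the factor 4 in the strict case is what
    rules out that a longer 4-adic interval lies in a shorter grid interval. *)
Lemma pow4_cmp k k' : (exists q, 4 ^ k = 4 * q.+1 * 4 ^ k')%N \/
  (exists q, 4 ^ k' = q.+1 * 4 ^ k)%N.
Proof.
have pgt m : (4 ^ m = (4 ^ m).-1.+1)%N by rewrite prednK// expn_gt0.
case: (ltnP k' k) => h; [left; exists (4 ^ (k - k').-1).-1|right; exists (4 ^ (k' - k)).-1].
  by rewrite -pgt -expnS -expnD; congr (_ ^ _)%N; lia.
by rewrite -pgt -expnD; congr (_ ^ _)%N; lia.
Qed.

Lemma itv4E I :
  itv4 R I = [set` `[(projT2 I)%:R / 4 ^+ projT1 I, (projT2 I).+1%:R / 4 ^+ projT1 I[].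
Proof.
by rewrite -(natr1 (projT2 I)) mulrDl mul1r.
Qed.

Lemma halfE s I : Defs.half R s I = [set` `[(4 * projT2 I + 2 * is_x s)%:R / 4 ^+ (projT1 I).+1,
   (4 * projT2 I + 2 * is_x s).+2%:R / 4 ^+ (projT1 I).+1[].
Proof.
have hn : 4 ^+ projT1 I != 0 :> R by rewrite expf_neq0.
have c1 (b : nat) : (4 * projT2 I + b)%:R / 4 ^+ (projT1 I).+1 =
    lo R I + b%:R * len R I / 4.
  by rewrite /lo /len exprS natrD natrM; field.
have -> : (4 * projT2 I + 2 * is_x s).+2 = (4 * projT2 I + (2 * is_x s).+2)%N by lia.
rewrite !c1 /Defs.half; case: s => /=.
  have -> : lo R I + 2%:R * len R I / 4 = lo R I + len R I / 2 by field.
  by have -> : lo R I + 4%:R * len R I / 4 = lo R I + len R I by field.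
have -> : lo R I + 0%:R * len R I / 4 = lo R I by field.
by have -> : lo R I + 2%:R * len R I / 4 = lo R I + len R I / 2 by field.
Qed.

(** Half of I has length twice that of its two 4-adic children, so a 4-adic
    interval inside it is too short to be cut by its midpoint. *)
Lemma D4_in_half s I : D4_in (Defs.half R s I) =
  D4_in (itv4 R (child s true I)) `|` D4_in (itv4 R (child s false I)).
Proof.
apply/seteqP; split=> J; rewrite /D4_in /=;
  rewrite halfE !(itv4E (child _ _ _)) !itv4_subset /=;
  set a := (4 * _ + 2 * _)%N; rewrite ?addn1 ?addn0;
  move: (projT2 J : nat) => n;
  case: (pow4_cmp (projT1 I).+1 (projT1 J)) => -[q ->];
  have := expn_gt0 4 (projT1 J); have := expn_gt0 4 (projT1 I).+1;
  move: (4 ^ projT1 J)%N (4 ^ (projT1 I).+1)%N => K' K /= K0 K'0.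
- by move=> []; nia.
- move=> [h1 h2]; case: (ltnP n ((a.+1) * q.+1)) => h; [right|left]; split; nia.
- by move=> []; nia.
- by move=> [] []; nia.
Qed.

Lemma D4_in_self I : D4_in (itv4 R I) =
  I |` (D4_in (Defs.half R Sx I) `|` D4_in (Defs.half R Sy I)).
Proof.
apply/seteqP; split=> J; last first.
  move=> [->//|]; rewrite /setU /D4_in /mkset !halfE (itv4E I) !itv4_subset /= expnS.
  by case; nia.
case: (eqVneq (projT1 J) (projT1 I)) => [e|ne].
  rewrite [D4_in _]/D4_in /mkset (itv4E I) itv4_subset => h; left; move: h.
  have K0 := expn_gt0 4 (projT1 I).
  have e2 n m : (m * 4 ^ projT1 J <= n * 4 ^ projT1 I)%N /\
      (n.+1 * 4 ^ projT1 I <= m.+1 * 4 ^ projT1 J)%N -> n = m.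
    by rewrite e; move: (4 ^ projT1 I)%N K0 => K /= K0 []; nia.
  move=> /e2; case: J e {e2} => kJ [nJ ltJ]; case: I {K0} => kI [nI ltI] /= e.
  subst kJ => e; subst nJ.
  by rewrite (bool_irrelevance ltJ ltI).
rewrite /setU /D4_in /mkset !halfE (itv4E I) !itv4_subset /= => h; right; move: h.
have [lt|ge] := ltnP (projT1 I) (projT1 J).
  case: (pow4_cmp (projT1 J) (projT1 I)) => -[q e].
    have e' : (4 ^ (projT1 I).+1 = 4 * 4 ^ projT1 I)%N by rewrite expnS.
    move: (projT2 J : nat) (projT2 I : nat) => n m; rewrite e e'.
    have := expn_gt0 4 (projT1 I); move: (4 ^ projT1 I)%N => K /= K0 [h1 h2].
    by case: (ltnP n ((4 * m + 2) * q.+1)) => h; [right|left]; split; nia.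
  have : (4 ^ projT1 I < 4 ^ projT1 J)%N by rewrite ltn_exp2l.
  by move: (projT2 J : nat) (projT2 I : nat) => n m; rewrite e; nia.
move: (projT2 J : nat) (projT2 I : nat) => n m.
have : (4 ^ projT1 J < 4 ^ projT1 I)%N by rewrite ltn_exp2l//; lia.
by case: (pow4_cmp (projT1 I) (projT1 J)) => -[q ->]; nia.
Qed.

Lemma itv4_sub_level I J : itv4 R J `<=` itv4 R I -> (projT1 I <= projT1 J)%N.
Proof.
rewrite [itv4 R I]itv4E itv4_subset.
move=> h; rewrite leqNgt; apply/negP => lt.
have : (4 ^ projT1 J < 4 ^ projT1 I)%N by rewrite ltn_exp2l.
move: h; move: (projT2 J : nat) (projT2 I : nat) => n m.
by case: (pow4_cmp (projT1 I) (projT1 J)) => -[q ->]; nia.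
Qed.

Lemma D4_in_child_disj s b b' I J : D4_in (itv4 R (child s b I)) J ->
  D4_in (itv4 R (child s b' I)) J -> b = b'.
Proof.
rewrite /D4_in /mkset !(itv4E (child _ _ _)) !itv4_subset /=.
move: (projT2 J : nat) (projT2 I : nat) => n m.
have := expn_gt0 4 (projT1 J); have := expn_gt0 4 (projT1 I).+1.
move: (4 ^ projT1 J)%N (4 ^ (projT1 I).+1)%N => K' K /=.
by case: b b' => -[] //= ? ? []; nia.
Qed.

Lemma D4_in_half_disj I J : D4_in (Defs.half R Sx I) J ->
  D4_in (Defs.half R Sy I) J -> False.
Proof.
rewrite /D4_in /mkset !halfE !itv4_subset /=.
move: (projT2 J : nat) (projT2 I : nat) => n m.
have := expn_gt0 4 (projT1 J); have := expn_gt0 4 (projT1 I).+1.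
move: (4 ^ projT1 J)%N (4 ^ (projT1 I).+1)%N => K' K /=.
by move=> ? ? [] ? ? []; nia.
Qed.

Lemma D4_in_half_self s I : ~ D4_in (Defs.half R s I) I.
Proof.
rewrite /D4_in /mkset halfE itv4_subset /= expnS.
move: (projT2 I : nat) => n; have := expn_gt0 4 (projT1 I).
by move: (4 ^ projT1 I)%N => K /=; case: s => /= ? []; nia.
Qed.

End Nesting.

(** * Sums over 4-adic intervals *)

Section Esum.
Variable R : realType.
Local Open Scope ereal_scope.

Lemma esumU (T : choiceType) (A B : set T) (a : T -> \bar R) :
  (forall i, 0 <= a i) -> (forall i, A i -> B i -> False) ->
  \esum_(i in A `|` B) a i = \esum_(i in A) a i + \esum_(i in B) a i.
Proof.
move=> a0 dis; rewrite (esumID A) //; congr (_ + _); congr esum.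
  by apply/seteqP; split=> x /=; [case|move=> Ax; split=> //; left].
apply/seteqP; split=> x /=; first by case=> -[].
by move=> Bx; split; [right|move=> Ax; exact: dis Ax Bx].
Qed.

Variable g : D4 -> \bar R.
Hypothesis g0 : forall I, 0 <= g I.

Definition mass I := \esum_(J in D4_in (itv4 R I)) g J.

Lemma mass_ge0 I : 0 <= mass I.
Proof. exact: esum_ge0. Qed.

Lemma esum_half s I :
  \esum_(J in D4_in (Defs.half R s I)) g J = mass (child s true I) + mass (child s false I).
Proof.
rewrite D4_in_half esumU// => J h1 h2.
by have := D4_in_child_disj h1 h2.
Qed.

Lemma mass_children I : mass I = g I +
  ((mass (child Sx true I) + mass (child Sx false I)) +
   (mass (child Sy true I) + mass (child Sy false I))).
Proof.
rewrite /mass D4_in_self esumU//; last first.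
  by move=> J -> [|]; exact: D4_in_half_self.
rewrite esum_set1// esumU//; first by rewrite !esum_half.
exact: D4_in_half_disj.
Qed.

(** Organizing the sum by levels makes its partial sums accessible to an
    induction on the level. *)
Lemma esum_D4 : \esum_(I in [set: D4]) g I =
  \sum_(0 <= k <oo) \sum_(i < (4 ^ k)%N) g (cell i).
Proof.
have -> : [set: D4] = \bigcup_(k in [set: nat]) ((@cell k) @` setT).
  apply/seteqP; split=> // -[k i] _; exists k => //; exists i => //.
rewrite nneseries_sum_bigcup//; last first.
  by move=> k k' _ _ [J [[i _ <-] [i' _]]] /(congr1 (@projT1 _ _)).
apply: eq_eseriesr => k _; rewrite esum_image; last first.
  by move=> i i' _ _ /(eq_from_Tagged (T_ := fun k : nat => 'I_(4 ^ k)%N)).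
have -> : [set: 'I_(4 ^ k)] = [set` enum 'I_(4 ^ k)].
  by apply/seteqP; split=> // i _; rewrite /= mem_enum.
by rewrite esum_fset// -fsbig_seq ?enum_uniq// big_enum.
Qed.
End Esum.

(** * Averages over one level *)

Section Averages.
Variable R : realType.
Implicit Types (F G u : D4 -> R) (I J : D4).

(** The integral over [0, 1) of the step function with values F on level k. *)
Definition mean F k : R := \sum_(i < (4 ^ k)%N) len R (cell i) * F (cell i).

Definition avg4 F I : R :=
  (F (child Sx true I) + F (child Sx false I) +
   (F (child Sy true I) + F (child Sy false I))) / 4.

Lemma sum_ord_mul4 (f : nat -> R) n :
  \sum_(i < (4 * n)%N) f i =
  \sum_(i < n) (f (4 * i + 3)%N + f (4 * i + 2)%N + (f (4 * i + 1)%N + f (4 * i)%N)).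
Proof.
elim: n => [|n IH]; first by rewrite muln0 !big_ord0.
have -> : (4 * n.+1 = (4 * n).+4)%N by lia.
by rewrite !big_ord_recr /= IH addn3 addn2 addn1; ring.
Qed.

(** Averaging over the children turns every inductive argument on levels into a
    statement about a single interval. *)
Lemma meanS F k : mean F k.+1 = mean (avg4 F) k.
Proof.
pose f (i : nat) : R := if insub i is Some j then F (@cell k.+1 j) else 0.
have fE (j : 'I_(4 ^ k.+1)) : F (cell j) = f j by rewrite /f valK.
rewrite /mean; under eq_bigr do rewrite fE.
have -> : \sum_(i < (4 ^ k.+1)%N) len R (cell i) * f i =
    \sum_(i < (4 * 4 ^ k)%N) (4 ^+ k.+1)^-1 * f i.
  by rewrite -expnS.
rewrite (sum_ord_mul4 (fun i => (4 ^+ k.+1)^-1 * f i)); apply: eq_bigr => i _.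
rewrite /avg4 !fE /= !muln1 !muln0 !addn0 -!addnA.
by rewrite /len /= exprS; field; rewrite expf_neq0.
Qed.

Lemma eq_mean F G k : (forall I, projT1 I = k -> F I = G I) -> mean F k = mean G k.
Proof. by move=> FG; apply: eq_bigr => i _; rewrite FG. Qed.

Lemma le_mean F G k : (forall I, projT1 I = k -> F I <= G I) -> mean F k <= mean G k.
Proof.
move=> FG; apply: ler_sum => i _.
by rewrite ler_wpM2l ?FG// ltW// len_gt0.
Qed.

Lemma meanD F G k : mean (fun I => F I + G I) k = mean F k + mean G k.
Proof. by rewrite /mean -big_split; apply: eq_bigr => i _; rewrite mulrDr. Qed.

Lemma meanZ a F k : mean (fun I => a * F I) k = a * mean F k.
Proof. by rewrite /mean mulr_sumr; apply: eq_bigr => i _; rewrite mulrCA. Qed.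

Lemma mean_ge0 F k : (forall I, 0 <= F I) -> 0 <= mean F k.
Proof. by move=> F0; apply: sumr_ge0 => i _; rewrite mulr_ge0// ltW// len_gt0. Qed.

End Averages.

(** * The cell and the ancestors of a point *)

Section Location.
Variable R : realType.
Implicit Types (F G u : D4 -> R) (I J : D4).

Lemma itv4_lo J : itv4 R J (lo R J).
Proof. by rewrite /itv4/= in_itv/= lexx ltrDl len_gt0. Qed.

Lemma itv4_I0 J : itv4 R J `<=` @I0 R.
Proof.
have -> : @I0 R = [set` `[0%:R / 4 ^+ 0, 1%:R / 4 ^+ 0[].
  by rewrite expr0 !divr1.
apply/itv4_subset; rewrite expn0 !muln1 mul0n mul1n.
by split=> //; exact: ltn_ord.
Qed.

Lemma itv4_child s b I : itv4 R (child s b I) `<=` itv4 R I.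
Proof.
suff : D4_in (itv4 R I) (child s b I) by [].
rewrite D4_in_self; right; case: s; [left|right];
  by rewrite D4_in_half; case: b; [left|right].
Qed.

(** The default value is never reached: for x in [0, 1) the integer part of
    4^n x is less than 4^n. *)
Definition locate n (x : R) : 'I_(4 ^ n)%N :=
  insubd (Ordinal (expn_gt0 4 n : (0 < 4 ^ n)%N)) (Num.truncn (4 ^+ n * x)).

Lemma itv4_locate n x : I0 x -> itv4 R (cell (locate n x)) x.
Proof.
rewrite /I0 /= in_itv/= => /andP[x0 x1].
have p4 : 0 < 4 ^+ n :> R by rewrite exprn_gt0.
have y0 : 0 <= 4 ^+ n * x by rewrite mulr_ge0// ltW.
have /andP[t1 t2] := truncn_itv y0.
have lt : (Num.truncn (4 ^+ n * x) < 4 ^ n)%N.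
  rewrite -(ltr_nat R) natrX (le_lt_trans t1)//.
  by rewrite -[ltRHS]mulr1 ltr_pM2l.
rewrite itv4E /= in_itv/= /locate val_insubd lt ler_pdivrMr// ltr_pdivlMr//.
by rewrite [x * _]mulrC t1 t2.
Qed.

Lemma itv4_inj n (i j : 'I_(4 ^ n)%N) x :
  itv4 R (cell i) x -> itv4 R (cell j) x -> i = j.
Proof.
rewrite !itv4E /= !in_itv/= => /andP[a b] /andP[c d].
have p4 : 0 < (4 ^+ n)^-1 :> R by rewrite invr_gt0 exprn_gt0.
have := le_lt_trans a d; have := le_lt_trans c b.
rewrite !ltr_pM2r// !ltr_nat => h1 h2; apply/val_inj => /=; lia.
Qed.

Lemma step_locate u n x : I0 x -> step u n x = u (cell (locate n x)).
Proof.
move=> x0; rewrite /step (bigD1 (locate n x))//= big1 ?addr0 => [|i ne].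
  by rewrite indicE mem_set ?mulr1//; exact: itv4_locate.
rewrite indicE memNset ?mulr0// => xi; move/eqP: ne; apply.
exact: itv4_inj xi (itv4_locate _ x0).
Qed.

(** Meaningful for n at most the level of J: the interval of level n that
    contains J is the one that contains its left end point. *)
Definition ancestor n J : D4 := cell (locate n (lo R J)).

Lemma itv4_ancestor n J : (n <= projT1 J)%N -> itv4 R J `<=` itv4 R (ancestor n J).
Proof.
move=> nJ; have := itv4_locate n (itv4_I0 (itv4_lo J)).
rewrite /ancestor !(itv4E R (cell _)) itv4_subset /= in_itv/=.
have pJ : 0 < 4 ^+ projT1 J :> R by rewrite exprn_gt0.
have pn : 0 < 4 ^+ n :> R by rewrite exprn_gt0.
move: (locate n (lo R J)) => b; rewrite /lo /len ler_pdivrMr// mulrAC ler_pdivlMr//.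
rewrite ltr_pdivlMr// mulrAC ltr_pdivrMr// -!natrX -!natrM ler_nat ltr_nat.
move: (projT2 J : nat) (b : nat) => a {}b.
have -> : (4 ^ projT1 J = 4 ^ (projT1 J - n) * 4 ^ n)%N by rewrite -expnD subnK.
have := expn_gt0 4 n; have := expn_gt0 4 (projT1 J - n).
move: (4 ^ n)%N (4 ^ (projT1 J - n))%N => K q /= K0 q0.
by rewrite !mulnA ltn_pmul2r// !leq_pmul2r// => /andP[].
Qed.

Lemma ancestor_eq n J x : (n <= projT1 J)%N -> itv4 R J x ->
  ancestor n J = cell (locate n x).
Proof.
move=> nJ xJ; congr cell; apply: itv4_inj (itv4_ancestor nJ xJ) (itv4_locate _ _).
exact: itv4_I0 xJ.
Qed.

Lemma ancestor_child n s b I : (n <= projT1 I)%N ->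
  ancestor n (child s b I) = ancestor n I.
Proof.
move=> nI; apply/esym/ancestor_eq => //.
exact: itv4_child (itv4_lo _).
Qed.

Lemma ancestor_id J : ancestor (projT1 J) J = J.
Proof.
case: J => n i; congr existT.
exact: (itv4_inj (itv4_locate n (itv4_I0 (itv4_lo (cell i)))) (itv4_lo (cell i))).
Qed.

End Location.

(** * Energy of a sliced martingale *)

Section Energy.
Variable R : realType.
Implicit Types (u : D4 -> R) (I J : D4).
Local Notation mu := (@lebesgue_measure R).

Definition energy u k : R := mean (fun I => u I ^+ 2) k.

(** Both slices have mean u_I, so the cross term between u_J - u_I and u_I - a
    vanishes on average. *)
Lemma avg4_variance u I a : sliced_martingale u ->
  avg4 (fun J => (u J - a) ^+ 2) I = (u I - a) ^+ 2 + (avg4 (fun J => u J ^+ 2) I - u I ^+ 2).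
Proof.
move=> /(_ I)[ex ey]; rewrite /avg4.
have -> : u (child Sx true I) = 2 * u I - u (child Sx false I) by rewrite ex; field.
have -> : u (child Sy true I) = 2 * u I - u (child Sy false I) by rewrite ey; field.
by field.
Qed.

Lemma energyS u k : energy u k.+1 = energy u k +
  mean (fun I => avg4 (fun J => u J ^+ 2) I - u I ^+ 2) k.
Proof. by rewrite /energy meanS -meanD; apply: eq_mean => I _; ring. Qed.

(** Pythagoras: by [avg4_variance], going one level down increases the distance
    to a fixed ancestor by the same amount as the energy. *)
Lemma mean_dist_ancestor u n m : sliced_martingale u -> (n <= m)%N ->
  mean (fun J => (u J - u (ancestor R n J)) ^+ 2) m = energy u m - energy u n.
Proof.
move=> mart; elim: m => [|m IH].
  rewrite leqn0 => /eqP ->; rewrite subrr /mean big1// => i _.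
  by have /= -> := ancestor_id R (cell i); rewrite subrr expr0n/= mulr0.
rewrite leq_eqVlt => /orP[/eqP ->|nm].
  rewrite subrr /mean big1// => i _.
  by have /= -> := ancestor_id R (cell i); rewrite subrr expr0n/= mulr0.
rewrite meanS energyS addrAC -IH// -meanD; apply: eq_mean => I Im.
have nI : (n <= projT1 I)%N by rewrite Im.
by rewrite -avg4_variance// /avg4 !ancestor_child.
Qed.

Lemma energy_homo u : sliced_martingale u -> {homo energy u : n m / (n <= m)%N >-> n <= m}.
Proof.
move=> mart n m nm; rewrite -subr_ge0 -mean_dist_ancestor//.
by apply: mean_ge0 => I; exact: sqr_ge0.
Qed.

Lemma measurable_I0 : measurable (@I0 R).
Proof. exact: measurable_itv. Qed.

Lemma measure_itv4 J : mu (itv4 R J `&` @I0 R) = (len R J)%:E.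
Proof.
rewrite setIidl; last exact: itv4_I0.
by rewrite /itv4 lebesgue_measure_itv/= lte_fin ltrDl len_gt0 -EFinD addrAC subrr add0r.
Qed.

Lemma measurable_step u n : measurable_fun (@I0 R) (step u n).
Proof.
apply: measurable_sum => i; apply: measurable_funM; first exact: measurable_cst.
by apply: measurable_indic; exact: measurable_itv.
Qed.

Lemma integral_step u n : (forall J, 0 <= u J) ->
  (\int[mu]_(x in @I0 R) (step u n x)%:E = (mean u n)%:E)%E.
Proof.
move=> u0.
under eq_integral do rewrite /step -sumEFin.
rewrite ge0_integral_sum//; last 3 first.
- exact: measurable_I0.
- move=> i; apply/measurable_EFinP; apply: measurable_funM; first exact: measurable_cst.
  by apply: measurable_indic; exact: measurable_itv.
- by move=> i x _; rewrite lee_fin mulr_ge0.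
rewrite /mean -sumEFin; apply: eq_bigr => i _.
under eq_integral do rewrite EFinM.
rewrite ge0_integralZl_EFin//; last 2 first.
- exact: measurable_I0.
- apply/measurable_EFinP; apply: measurable_indic; exact: measurable_itv.
rewrite integral_indic//; [|exact: measurable_I0|exact: measurable_itv].
by rewrite [X in (_ * X)%E](measure_itv4 (cell i)) -EFinM mulrC.
Qed.

Lemma integral_step_sqr u n :
  (\int[mu]_(x in @I0 R) (step u n x ^+ 2)%:E = (energy u n)%:E)%E.
Proof.
rewrite -integral_step; last by move=> J; exact: sqr_ge0.
by apply: eq_integral => x /[1!inE] x0; rewrite !step_locate.
Qed.

Lemma step_sub u n m x : (n <= m)%N -> @I0 R x ->
  step u m x - step u n x = step (fun J => u J - u (ancestor R n J)) m x.
Proof.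
move=> nm x0; rewrite !step_locate//.
by rewrite (@ancestor_eq _ n (cell (locate m x)) x)//; exact: itv4_locate.
Qed.

Lemma integral_step_dist u n m : sliced_martingale u ->
  (\int[mu]_(x in @I0 R) ((step u n x - step u m x) ^+ 2)%:E
    = `|energy u m - energy u n|%:E)%E.
Proof.
move=> mart; wlog nm : n m / (n <= m)%N.
  move=> H; case: (leqP n m) => [|/ltnW] nm; first exact: H.
  by rewrite distrC -H//; apply: eq_integral => x _; rewrite -sqrrN opprB.
rewrite ger0_norm ?subr_ge0; last exact: energy_homo.
rewrite -mean_dist_ancestor// -integral_step; last by move=> J; exact: sqr_ge0.
apply: eq_integral => x /[1!inE] x0.
by rewrite -sqrrN opprB step_sub// !step_locate.
Qed.

(** The total mass of [0, 1) is 1, so an L^2 bound gives an L^1 bound; this is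
    what makes a fast subsequence absolutely summable almost everywhere. *)
Lemma integral_step_dist1 u n m (e : R) : sliced_martingale u -> (n <= m)%N -> 0 < e ->
  energy u m - energy u n <= e ^+ 2 ->
  (\int[mu]_(x in @I0 R) (`|step u m x - step u n x|)%:E <= e%:E)%E.
Proof.
move=> mart nm e0 le.
have -> : (\int[mu]_(x in @I0 R) (`|step u m x - step u n x|)%:E =
    (mean (fun J => `|u J - u (ancestor R n J)|) m)%:E)%E.
  rewrite -integral_step//; apply: eq_integral => x /[1!inE] x0.
  by rewrite step_sub// !step_locate.
have m1 : mean (fun=> 1 : R) m = 1.
  elim: (m) => [|k IH]; first by rewrite /mean big_ord1 /len expr0 invr1 mulr1.
  by rewrite meanS -[RHS]IH; apply: eq_mean => I _; rewrite /avg4; field.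
have eE : e = (2 * e)^-1 * (e ^+ 2) + (e / 2) * 1 by field; rewrite gt_eqF.
rewrite lee_fin [leRHS]eE.
rewrite (@le_trans _ _
  ((2 * e)^-1 * (energy u m - energy u n) + (e / 2) * 1))//; last first.
  by rewrite lerD2r ler_wpM2l// invr_ge0 mulr_ge0// ltW.
rewrite -mean_dist_ancestor// -[X in _ <= _ + _ * X]m1 -!meanZ -meanD; apply: le_mean => J _.
(* The arithmetic-geometric inequality, with the weight e that matches the
   bound e ^+ 2 on the energy increment. *)
rewrite -(real_normK (num_real (u J - _))).
move: `|_| => y; rewrite -subr_ge0.
have -> : (2 * e)^-1 * y ^+ 2 + e / 2 * 1 - y = (2 * e)^-1 * (y - e) ^+ 2.
  by field; rewrite gt_eqF.
by rewrite mulr_ge0 ?sqr_ge0// invr_ge0 mulr_ge0// ltW.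
Qed.

End Energy.

(** * The square norm of an L^2 limit *)

Section L2Limit.
Variable R : realType.
Implicit Types (u : D4 -> R) (f g U : R -> R).
Local Notation mu := (@lebesgue_measure R).
Local Notation I0 := (@I0 R).

Lemma measurable_sqr_EFin f : measurable_fun I0 f ->
  measurable_fun I0 (fun x => (f x ^+ 2)%:E).
Proof. by move=> mf; apply/measurable_EFinP; exact: measurable_funX. Qed.

Lemma le_integral_comb f g (h k : R -> R) (t c : R) : 0 <= t -> 0 <= c ->
  measurable_fun I0 f -> measurable_fun I0 g ->
  measurable_fun I0 h -> measurable_fun I0 k ->
  (forall x, f x ^+ 2 <= g x ^+ 2 + t * h x ^+ 2 + c * k x ^+ 2) ->
  (\int[mu]_(x in I0) (f x ^+ 2)%:E <= \int[mu]_(x in I0) (g x ^+ 2)%:E +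
    t%:E * \int[mu]_(x in I0) (h x ^+ 2)%:E + c%:E * \int[mu]_(x in I0) (k x ^+ 2)%:E)%E.
Proof.
move=> t0 c0 mf mg mh mk le.
have mI := @measurable_I0 R.
have pos (w : R -> R) x : I0 x -> (0 <= (w x ^+ 2)%:E)%E by rewrite lee_fin sqr_ge0.
rewrite -!ge0_integralZl_EFin//; try exact: pos; try exact: measurable_sqr_EFin.
have mZ (w : R -> R) (a : R) : measurable_fun I0 w ->
    measurable_fun I0 (fun x => (a%:E * (w x ^+ 2)%:E)%E).
  by move=> mw; apply: measurable_funeM; exact: measurable_sqr_EFin.
have pZ (w : R -> R) (a : R) x : 0 <= a -> (0 <= a%:E * (w x ^+ 2)%:E)%E.
  by move=> a0; rewrite -EFinM lee_fin mulr_ge0 ?sqr_ge0.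
rewrite -ge0_integralD//; do ?[exact: pos|by move=> x _; exact: pZ
  |exact: measurable_sqr_EFin|exact: mZ].
rewrite -ge0_integralD//; do ?[by move=> x _; exact: pZ|exact: mZ]; last 2 first.
- by move=> x Ix; apply: adde_ge0; [exact: pos|exact: pZ].
- by apply: emeasurable_funD; [exact: measurable_sqr_EFin|exact: mZ].
apply: ge0_le_integral => //; [exact: pos|exact: measurable_sqr_EFin|idtac|].
  apply: emeasurable_funD; last exact: mZ.
  by apply: emeasurable_funD; [exact: measurable_sqr_EFin|exact: mZ].
by move=> x _; rewrite -!EFinM -!EFinD lee_fin.
Qed.

(** A quantitative triangle inequality for squares that needs no square roots
    of integrals: t can be sent to 0 after the distance has become small. *)
Lemma sqr_split (a b t : R) : 0 < t ->
  a ^+ 2 <= b ^+ 2 + t * b ^+ 2 + (1 + t^-1) * (a - b) ^+ 2 /\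
  b ^+ 2 <= a ^+ 2 + t * b ^+ 2 + (1 + t^-1) * (a - b) ^+ 2.
Proof.
move=> t0; have tn : t != 0 by rewrite gt_eqF.
split; rewrite -subr_ge0.
  have -> : b ^+ 2 + t * b ^+ 2 + (1 + t^-1) * (a - b) ^+ 2 - a ^+ 2 =
    t^-1 * (t * b - (a - b)) ^+ 2 by field.
  by apply: mulr_ge0; [rewrite invr_ge0 ltW|exact: sqr_ge0].
have -> : a ^+ 2 + t * b ^+ 2 + (1 + t^-1) * (a - b) ^+ 2 - b ^+ 2 =
    t^-1 * (t * b + (a - b)) ^+ 2 + 2 * (a - b) ^+ 2 by field.
by apply: addr_ge0; apply: mulr_ge0; rewrite ?sqr_ge0 ?invr_ge0// ltW.
Qed.

Lemma L2_limit_energy u U : is_L2_limit u U ->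
  exists2 b : R, (\int[mu]_(x in I0) (U x ^+ 2)%:E = b%:E)%E &
    energy u n @[n --> \oo] --> b.
Proof.
move=> [mU iU lim0].
have fin : (\int[mu]_(x in I0) (U x ^+ 2)%:E \is a fin_num)%E.
  by apply: integrable_fin_num => //; exact: measurable_I0.
exists (fine (\int[mu]_(x in I0) (U x ^+ 2)%:E)); first by rewrite fineK.
set b := fine _.
have bE : (\int[mu]_(x in I0) (U x ^+ 2)%:E = b%:E)%E by rewrite fineK.
have b0 : 0 <= b by apply: fine_ge0; apply: integral_ge0 => x _; rewrite lee_fin sqr_ge0.
apply/cvgrPdist_le => e e0.
(* t makes the term t * b at most e / 2; the denominator b + 1 avoids
   dividing by a vanishing norm. *)
pose t := e / 2 / (b + 1).
have t0 : 0 < t by rewrite divr_gt0 ?divr_gt0// ltr_wpDl.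
have tb : t * b <= e / 2.
  rewrite /t mulrAC ler_pdivrMr ?ltr_wpDl// ler_pM2l ?divr_gt0//.
  by rewrite lerDl.
pose c := 1 + t^-1.
have c0 : 0 < c by rewrite addr_gt0// invr_gt0.
have /fine_cvgP[fe] := lim0.
move=> /cvgrPdist_le /(_ (e / 2 / c)); rewrite divr_gt0 ?divr_gt0// => /(_ isT) small.
near=> n.
set d := (\int[mu]_(x in I0) ((step u n x - U x) ^+ 2)%:E)%E.
have fd : d \is a fin_num by rewrite /d; near: n; exact: fe.
have ms := measurable_step u n.
have md : measurable_fun I0 (fun x => step u n x - U x) by exact: measurable_funB.
have : `|0 - fine d| <= e / 2 / c by rewrite /d; near: n; exact: small.
rewrite sub0r normrN => sd.
have cd : c * fine d <= e / 2.
  rewrite mulrC -ler_pdivlMr//; exact: le_trans (ler_norm _) sd.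
have h1 : (\int[mu]_(x in I0) (step u n x ^+ 2)%:E <= \int[mu]_(x in I0) (U x ^+ 2)%:E +
    t%:E * \int[mu]_(x in I0) (U x ^+ 2)%:E + c%:E * d)%E.
  apply: le_integral_comb => //; [exact: ltW|exact: ltW|].
  by move=> x; have [] := sqr_split (step u n x) (U x) t0.
have h2 : (\int[mu]_(x in I0) (U x ^+ 2)%:E <= \int[mu]_(x in I0) (step u n x ^+ 2)%:E +
    t%:E * \int[mu]_(x in I0) (U x ^+ 2)%:E + c%:E * d)%E.
  apply: le_integral_comb => //; [exact: ltW|exact: ltW|].
  by move=> x; have [] := sqr_split (step u n x) (U x) t0.
move: h1 h2; rewrite integral_step_sqr bE -(fineK fd) -!EFinM -!EFinD !lee_fin => h1 h2.
rewrite ler_norml; apply/andP; split; lra.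
Unshelve. all: by end_near.
Qed.

(** Step functions are square integrable, and so is anything at finite L^2
    distance from one. *)
Lemma sqr_integrable_near_step u n U : measurable_fun I0 U ->
  (\int[mu]_(x in I0) ((step u n x - U x) ^+ 2)%:E < +oo)%E ->
  mu.-integrable I0 (fun x => (U x ^+ 2)%:E).
Proof.
move=> mU fin; apply/integrableP; split; first exact: measurable_sqr_EFin.
have ms := measurable_step u n.
have md : measurable_fun I0 (fun x => step u n x - U x) by exact: measurable_funB.
have -> : (\int[mu]_(x in I0) `|(U x ^+ 2)%:E| = \int[mu]_(x in I0) (U x ^+ 2)%:E)%E.
  by apply: eq_integral => x _; rewrite gee0_abs// lee_fin sqr_ge0.
apply: (@le_lt_trans _ _ (\int[mu]_(x in I0) (step u n x ^+ 2)%:E +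
    1%:E * \int[mu]_(x in I0) (step u n x ^+ 2)%:E +
    2%:E * \int[mu]_(x in I0) ((step u n x - U x) ^+ 2)%:E)%E).
  apply: le_integral_comb => // x.
  have [+ _] := sqr_split (U x) (step u n x) ltr01.
  by rewrite invr1 -[X in 2 * X]sqrrN opprB.
rewrite integral_step_sqr -EFinM -EFinD.
by apply: lte_add_pinfty; rewrite ?ltry// lte_mul_pinfty// lee_fin.
Qed.

End L2Limit.

(** * Existence of the L^2 limit *)

Section L2LimitExists.
Variable R : realType.
Variable u : D4 -> R.
Hypothesis mart : sliced_martingale u.
Hypothesis bound : L2_integrable u.
Local Notation mu := (@lebesgue_measure R).
Local Notation I0 := (@I0 R).

Lemma energy_cvg : cvgn (energy u).
Proof.
have [M uM] := bound.
apply: nondecreasing_is_cvgn; first exact: energy_homo.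
by exists M => _ [n _ <-]; exact: uM.
Qed.

Let Einf := limn (energy u).

(** Adding k and a partial sum of the moduli of convergence makes the
    subsequence monotone and unbounded. *)
Lemma fast_subsequence : exists phi : nat -> nat,
  [/\ forall k, (k <= phi k)%N, forall k, (phi k <= phi k.+1)%N &
    forall k, energy u (phi k.+1) - energy u (phi k) <= (1 / (2 ^ k.+1)%:R) ^+ 2].
Proof.
have /choice[psi psiP] : forall k, exists N, forall m, (N <= m)%N ->
    Einf - energy u m <= (1 / (2 ^ k.+1)%:R) ^+ 2 :> R.
  move=> k; have /cvgrPdist_le := energy_cvg.
  move=> /(_ ((1 / (2 ^ k.+1)%:R) ^+ 2)); rewrite exprn_gt0 ?divr_gt0 ?ltr0n ?expn_gt0//.
  move=> /(_ isT)[N _ H]; exists N => m /H/=.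
  exact: le_trans (ler_norm _).
exists (fun k => k + \sum_(i < k.+1) psi i)%N; split=> k.
- exact: leq_addr.
- by rewrite /= [X in (_ <= _ + X)%N]big_ord_recr/=; lia.
- apply: le_trans (psiP k (k + \sum_(i < k.+1) psi i)%N _); last first.
    by rewrite big_ord_recr/=; lia.
  by rewrite lerD2r; apply: nondecreasing_cvgn_le; [exact: energy_homo|exact: energy_cvg].
Qed.

(** The sum of the absolute increments has a finite integral, hence is finite
    almost everywhere, and there the increments telescope. *)
Lemma subsequence_ae_cvg (phi : nat -> nat) :
    (forall k, (phi k <= phi k.+1)%N) ->
    (forall k, energy u (phi k.+1) - energy u (phi k) <= (1 / (2 ^ k.+1)%:R) ^+ 2) ->
  {ae mu, forall x, I0 x -> cvgn (fun k => step u (phi k) x)}.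
Proof.
move=> phiS fast.
pose d k x := step u (phi k.+1) x - step u (phi k) x.
have md k : measurable_fun I0 (fun x => (`|d k x|)%:E).
  apply/measurable_EFinP; apply: measurableT_comp; first exact: normr_measurable.
  by apply: measurable_funB; exact: measurable_step.
have mS : measurable_fun I0 (fun x => \sum_(0 <= k <oo) (`|d k x|)%:E)%E.
  by apply: ge0_emeasurable_sum => // k x _ _; rewrite lee_fin.
have intS : mu.-integrable I0 (fun x => \sum_(0 <= k <oo) (`|d k x|)%:E)%E.
  apply/integrableP; split=> //.
  have -> : (\int[mu]_(x in I0) `|\sum_(0 <= k <oo) (`|d k x|)%:E| =
      \int[mu]_(x in I0) \sum_(0 <= k <oo) (`|d k x|)%:E)%E.
    apply: eq_integral => x _; rewrite gee0_abs//.
    by apply: nneseries_ge0 => k _ _; rewrite lee_fin.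
  rewrite integral_nneseries//; last exact: measurable_I0.
  apply: (@le_lt_trans _ _ (\sum_(0 <= k <oo) (1 / (2 ^ k.+1)%:R : R)%:E)%E).
    apply: lee_nneseries => [k _ _|k _]; first by apply: integral_ge0 => x _; rewrite lee_fin.
    by apply: integral_step_dist1 => //; rewrite divr_gt0 ?ltr0n ?expn_gt0.
  by apply: le_lt_trans (epsilon_trick0 xpredT ler01) _; rewrite ltry.
have : {ae mu, forall x, I0 x -> (\sum_(0 <= k <oo) (`|d k x|)%:E)%E \is a fin_num}.
  by apply: integrable_ae intS; exact: measurable_I0.
apply: filterS; first exact: (ae_filter_ringOfSetsType mu).
move=> x fin x0; have {fin} fin := fin x0.
have : cvgn (series (d^~ x)).
  apply: normed_cvg; apply: nondecreasing_is_cvgn.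
    apply/nondecreasing_seqP => n; rewrite /= !seriesEnat/= big_nat_recr//=.
    by rewrite lerDl.
  exists (fine (\sum_(0 <= k <oo) (`|d k x|)%:E)%E) => _ [n _ <-].
  rewrite -lee_fin fineK// /normed_series_of seriesEnat /= -sumEFin.
  by apply: nneseries_lim_ge => k _ _; rewrite lee_fin.
have -> : d^~ x = telescope (fun k => step u (phi k) x) by [].
rewrite telescopeK => cv.
have -> : (fun k => step u (phi k) x) =
    (fun k => (step u (phi k) x - step u (phi 0%N) x) + step u (phi 0%N) x).
  by apply/funext => k; rewrite subrK.
apply: is_cvgD cv _; exact: is_cvg_cst.
Qed.

(** Riesz-Fischer for martingales: Fatou's lemma along the subsequence bounds
    the distance from level n to the pointwise limit by the energy still to come
    after level n. *)
Lemma L2_limit_exists : exists U, is_L2_limit u U.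
Proof.
have [phi [phige phiS fast]] := fast_subsequence.
have ae := subsequence_ae_cvg phiS fast.
(* The upper limit is measurable without any exceptional set; it is the
   limit wherever the latter exists. *)
pose U x := fine (limn_esup (fun k => (step u (phi k) x)%:E)).
have mU : measurable_fun I0 U.
  apply: measurableT_comp; first exact: fine_measurable.
  apply: measurable_fun_limn_esup => k; apply/measurable_EFinP; exact: measurable_step.
have UE x : cvgn (fun k => step u (phi k) x) ->
    step u (phi k) x @[k --> \oo] --> U x.
  move=> cv; rewrite /U.
  have -> : limn_esup (fun k => (step u (phi k) x)%:E) =
      (limn (fun k => step u (phi k) x))%:E.
    by apply: (cvg_limn_einf_sup _).2; apply: cvg_EFin cv; exact: nearW.
  exact: cv.
have phi_oo : phi k @[k --> \oo] --> \oo.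
  apply/cvgnyPge => A; near=> k; rewrite (leq_trans _ (phige k))//.
  by near: k; exact: nbhs_infty_ge.
have dist n : (\int[mu]_(x in I0) ((step u n x - U x) ^+ 2)%:E <= `|Einf - energy u n|%:E)%E.
  have md k : measurable_fun I0 (fun x => ((step u n x - step u (phi k) x) ^+ 2)%:E).
    by apply: measurable_sqr_EFin; apply: measurable_funB; exact: measurable_step.
  have -> : (\int[mu]_(x in I0) ((step u n x - U x) ^+ 2)%:E =
      \int[mu]_(x in I0) limn_einf (fun k => ((step u n x - step u (phi k) x) ^+ 2)%:E))%E.
    apply: ae_eq_integral.
    - exact: measurable_I0.
    - apply: measurable_sqr_EFin; apply: measurable_funB => //; exact: measurable_step.
    - apply: measurableT_comp; first exact: oppe_measurable.
      apply: measurable_fun_limn_esup => k; apply: measurableT_comp (md k).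
      exact: oppe_measurable.
    move: ae; apply: filterS; first exact: (ae_filter_ringOfSetsType mu).
    move=> x cx x0; apply/esym.
    apply: (cvg_limn_einf_sup _).1.
    apply: cvg_EFin; first exact: nearW.
    rewrite expr2; under eq_cvg do rewrite /= expr2.
    by apply: cvgM; apply: cvgB; (exact: cvg_cst || exact: UE (cx x0)).
  apply: le_trans (fatou _ _ _ _) _ => //; [exact: measurable_I0| |].
    by move=> k x _; rewrite lee_fin sqr_ge0.
  rewrite (_ : limn_einf _ = `|Einf - energy u n|%:E)//.
  apply: (cvg_limn_einf_sup _).1.
  under eq_cvg do rewrite integral_step_dist//.
  apply: cvg_EFin; first exact: nearW.
  apply: cvg_norm; apply: cvgB; last exact: cvg_cst.
  exact: cvg_comp phi_oo energy_cvg.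
exists U; split => //.
  apply: (@sqr_integrable_near_step _ u 0%N) => //.
  exact: le_lt_trans (dist 0%N) (ltry _).
apply: (@squeeze_cvge _ _ _ _ (cst 0%E) _ (fun n => `|Einf - energy u n|%:E)).
- apply: nearW => n; rewrite dist andbT; apply: integral_ge0 => x _.
  by rewrite lee_fin sqr_ge0.
- exact: cvg_cst.
apply: cvg_EFin; first exact: nearW.
rewrite -(normr0 R) -[X in `|X|](subrr Einf).
by apply: cvg_norm; apply: cvgB; [exact: cvg_cst|exact: energy_cvg].
Unshelve. all: by end_near.
Qed.

End L2LimitExists.

(** * The Hardy norm as a limit of energies *)

Section HardyNorm.
Variable R : realType.
Implicit Types (u v : D4 -> R).
Local Notation mu := (@lebesgue_measure R).

Lemma L2_limitP u : sliced_martingale u -> L2_integrable u -> is_L2_limit u (L2_limit u).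
Proof. by move=> mart bound; have [U] := L2_limit_exists mart bound; exact: xgetI. Qed.

(** The squared norm does not depend on the representatives chosen for the L^2
    limits, since each of their square norms is the limit of the energies. *)
Lemma hardy_norm_sqE u v : hardy u v ->
  exists2 b : R, hardy_norm_sq u v = b%:E &
    energy u n + energy v n @[n --> \oo] --> b.
Proof.
move=> [[martu bu] [martv bv] _].
have lu := L2_limitP martu bu; have lv := L2_limitP martv bv.
have [nu Eu cu] := L2_limit_energy lu; have [nv Ev cv] := L2_limit_energy lv.
exists (nu + nv); last exact: cvgD.
rewrite /hardy_norm_sq EFinD -Eu -Ev; under eq_integral do rewrite EFinD.
case: lu lv => [mU _ _] [mV _ _].
rewrite ge0_integralD//; do ?exact: measurable_sqr_EFin.
- exact: measurable_I0.
- by move=> x _; rewrite lee_fin sqr_ge0.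
- by move=> x _; rewrite lee_fin sqr_ge0.
Qed.

Lemma energy_le_hardy_norm_sq u v n : hardy u v ->
  ((energy u n + energy v n)%:E <= hardy_norm_sq u v)%E.
Proof.
move=> h; have [b -> cb] := hardy_norm_sqE h; case: h => -[martu _] [martv _] _.
rewrite lee_fin -(cvg_lim _ cb)//.
apply: (@nondecreasing_cvgn_le _ (fun n => energy u n + energy v n)).
  by move=> i j ij; apply: lerD; exact: energy_homo.
by apply/cvg_ex; exists b.
Qed.

End HardyNorm.

(** * The embedding *)

Section Embedding.
Variable R : realType.
Implicit Types (u v A m : D4 -> R).

(** With d = p + iq the four children carry f + d, f - d, f + id, f - id, and the
    potential moves by +-a in one slice and by +-b in the other.  Minimizing over
    d, the claim becomes
    sinh^2 a + sinh^2 b <= (cosh a + cosh b) (cosh a + cosh b - 2),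
    and the difference of the two sides is 2 (cosh a - 1) (cosh b - 1). *)
Lemma weighted_children_ge (u v p q a b : R) :
  u ^+ 2 + v ^+ 2 <=
   (((u + p) ^+ 2 + (v + q) ^+ 2) * expR (- a) + ((u - p) ^+ 2 + (v - q) ^+ 2) * expR a +
    (((u - q) ^+ 2 + (v + p) ^+ 2) * expR (- b) + ((u + q) ^+ 2 + (v - p) ^+ 2) * expR b)) / 4.
Proof.
rewrite !expRN.
have := expR_gt0 a; have := expR_gt0 b.
move: (expR a) (expR b) => x y y0 x0.
have xn : x != 0 by rewrite gt_eqF.
have yn : y != 0 by rewrite gt_eqF.
(* the hyperbolic cosines and sines of a and b *)
pose ca := (x^-1 + x) / 2; pose sa := (x - x^-1) / 2.
pose cb := (y^-1 + y) / 2; pose sb := (y - y^-1) / 2.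
have ha : ca ^+ 2 = 1 + sa ^+ 2 by rewrite /ca /sa; field.
have hb : cb ^+ 2 = 1 + sb ^+ 2 by rewrite /cb /sb; field.
have ca1 : 1 <= ca.
  rewrite -subr_ge0 (_ : ca - 1 = (x - 1) ^+ 2 / (2 * x)); last by rewrite /ca; field.
  by rewrite divr_ge0 ?sqr_ge0 ?mulr_ge0 ?ltW.
have cb1 : 1 <= cb.
  rewrite -subr_ge0 (_ : cb - 1 = (y - 1) ^+ 2 / (2 * y)); last by rewrite /cb; field.
  by rewrite divr_ge0 ?sqr_ge0 ?mulr_ge0 ?ltW.
have -> : (((u + p) ^+ 2 + (v + q) ^+ 2) * x^-1 + ((u - p) ^+ 2 + (v - q) ^+ 2) * x +
    (((u - q) ^+ 2 + (v + p) ^+ 2) * y^-1 + ((u + q) ^+ 2 + (v - p) ^+ 2) * y)) / 4 =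
  ((u ^+ 2 + v ^+ 2 + p ^+ 2 + q ^+ 2) * (ca + cb) - 2 * (u * p + v * q) * sa
    - 2 * (v * p - u * q) * sb) / 2.
  by rewrite /ca /cb /sa /sb; field; rewrite xn yn.
have S0 : 0 < ca + cb by lra.
rewrite -subr_ge0.
(* Completing the square in p and q; what is left over is proportional to
   (ca - 1) * (cb - 1), which is nonnegative. *)
have -> : ((u ^+ 2 + v ^+ 2 + p ^+ 2 + q ^+ 2) * (ca + cb) - 2 * (u * p + v * q) * sa
    - 2 * (v * p - u * q) * sb) / 2 - (u ^+ 2 + v ^+ 2) =
  (((ca + cb) * p - (u * sa + v * sb)) ^+ 2 + ((ca + cb) * q - (v * sa - u * sb)) ^+ 2
   + (u ^+ 2 + v ^+ 2) * ((ca + cb) ^+ 2 - 2 * (ca + cb) - (sa ^+ 2 + sb ^+ 2))) / (2 * (ca + cb)).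
  by field; rewrite gt_eqF.
have -> : (ca + cb) ^+ 2 - 2 * (ca + cb) - (sa ^+ 2 + sb ^+ 2) = 2 * ((ca - 1) * (cb - 1)).
  have -> : sa ^+ 2 = ca ^+ 2 - 1 by rewrite ha; ring.
  have -> : sb ^+ 2 = cb ^+ 2 - 1 by rewrite hb; ring.
  by ring.
apply: divr_ge0; last by rewrite mulr_ge0// ltW.
apply: addr_ge0; first by rewrite addr_ge0 ?sqr_ge0.
by rewrite mulr_ge0 ?addr_ge0 ?sqr_ge0// mulr_ge0// mulr_ge0// subr_ge0.
Qed.

(** The dyadic counterpart of |f|^2 e^phi for the bounded subharmonic weight
    phi = - A / C. *)
Definition bellman (C : R) u v A I : R :=
  (u I ^+ 2 + v I ^+ 2) * expR (- (A I / C)).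

(** The balance condition in terms of normalized masses: A is superharmonic
    along each slice separately, with the same defect m. *)
Definition carleson_potential A m := forall I s,
  A I = m I + (A (child s true I) + A (child s false I)) / 2.

(** First lower the potential by m_I, which gains the Carleson term, then split it
    among the children.  The constant e is the ratio of the extreme values of
    the weight exp (- A_I / C). *)
Lemma bellman_step (C : R) u v A m I : 0 < C ->
  sliced_martingale u -> sliced_martingale v -> cauchy_riemann u v ->
  0 <= m I -> A I <= C -> carleson_potential A m ->
  bellman C u v A I + expR (-1) / C * (m I * (u I ^+ 2 + v I ^+ 2)) <=
    avg4 (bellman C u v A) I.
Proof.
move=> C0 martu martv cr m0 AC pot.
have [ux uy] := martu I; have [vx vy] := martv I; have [cr1 cr2] := cr I.
have Ax := pot I Sx; have Ay := pot I Sy.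
rewrite /Delta in cr1 cr2.
set F := u I ^+ 2 + v I ^+ 2.
have F0 : 0 <= F by rewrite addr_ge0 ?sqr_ge0.
(* The value of the potential between the two moves. *)
pose B := A I - m I.
pose p := u (child Sx true I) - u I; pose q := v (child Sx true I) - v I.
pose a := (A (child Sx true I) - B) / C; pose b := (A (child Sy true I) - B) / C.
have Cn : C != 0 by rewrite gt_eqF.
have split_exp (z w : R) : expR (- ((B + w * C) / C)) = expR (- (B / C)) * expR (- w).
  by rewrite -expRD; congr expR; field.
have step : expR (- (B / C)) * F <= avg4 (bellman C u v A) I.
  have le := weighted_children_ge (u I) (v I) p q a b.
  have -> : avg4 (bellman C u v A) I = expR (- (B / C)) *
   ((((u I + p) ^+ 2 + (v I + q) ^+ 2) * expR (- a) + ((u I - p) ^+ 2 + (v I - q) ^+ 2) * expR a +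
    (((u I - q) ^+ 2 + (v I + p) ^+ 2) * expR (- b) +
     ((u I + q) ^+ 2 + (v I - p) ^+ 2) * expR b)) / 4).
    rewrite /avg4 /bellman.
    have -> : u (child Sx true I) = u I + p by rewrite /p; ring.
    have -> : v (child Sx true I) = v I + q by rewrite /q; ring.
    have -> : u (child Sx false I) = u I - p by rewrite /p; lra.
    have -> : v (child Sx false I) = v I - q by rewrite /q; lra.
    have -> : u (child Sy true I) = u I - q by rewrite /q; lra.
    have -> : v (child Sy true I) = v I + p by rewrite /p; lra.
    have -> : u (child Sy false I) = u I + q by rewrite /q; lra.
    have -> : v (child Sy false I) = v I - p by rewrite /p; lra.
    have -> : A (child Sx true I) = B + a * C by rewrite /a; field.
    have -> : A (child Sx false I) = B + (- a) * C.
      by rewrite /a /B Ax; field.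
    have -> : A (child Sy true I) = B + b * C by rewrite /b; field.
    have -> : A (child Sy false I) = B + (- b) * C.
      by rewrite /b /B Ay; field.
    by rewrite !split_exp// !opprK; ring.
  by rewrite ler_pM2l ?expR_gt0.
apply: le_trans step.
have -> : expR (- (B / C)) = expR (- (A I / C)) * expR (m I / C).
  by rewrite -expRD; congr expR; rewrite /B; field.
rewrite /bellman -/F.
have le1 : 1 + m I / C <= expR (m I / C) by exact: expR_ge1Dx.
have le2 : expR (-1) <= expR (- (A I / C)).
  by rewrite ler_expR lerN2 ler_pdivrMr// mul1r.
apply: (@le_trans _ _ (expR (- (A I / C)) * (1 + m I / C) * F)); last first.
  by rewrite ler_wpM2r// ler_pM2l ?expR_gt0.
have -> : expR (- (A I / C)) * (1 + m I / C) * F = F * expR (- (A I / C)) +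
   expR (- (A I / C)) * (m I / C * F) by ring.
have -> : expR (-1) / C * (m I * F) = expR (-1) * (m I / C * F) by ring.
by rewrite lerD2l ler_wpM2r// mulr_ge0// divr_ge0// ltW.
Qed.

Lemma carleson_sum_le (C : R) u v A m n : 0 < C ->
  sliced_martingale u -> sliced_martingale v -> cauchy_riemann u v ->
  (forall I, 0 <= m I) -> (forall I, 0 <= A I <= C) -> carleson_potential A m ->
  \sum_(0 <= k < n) mean (fun I => m I * (u I ^+ 2 + v I ^+ 2)) k <=
    expR 1 * C * (energy u n + energy v n).
Proof.
move=> C0 martu martv cr m0 AC pot.
have B0 I : 0 <= bellman C u v A I.
  by rewrite mulr_ge0 ?expR_ge0 ?addr_ge0 ?sqr_ge0.
have ge : expR (-1) / C * \sum_(0 <= k < n) mean (fun I => m I * (u I ^+ 2 + v I ^+ 2)) k <=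
    mean (bellman C u v A) n.
  elim: n => [|n IH]; first by rewrite big_nil mulr0; exact: mean_ge0.
  rewrite big_nat_recr//= mulrDr meanS -meanZ.
  apply: (@le_trans _ _ (mean (bellman C u v A) n +
      mean (fun I => expR (-1) / C * (m I * (u I ^+ 2 + v I ^+ 2))) n)).
    by rewrite lerD2r.
  rewrite -meanD; apply: le_mean => I _.
  by apply: bellman_step => //; have /andP[] := AC I.
have le : mean (bellman C u v A) n <= energy u n + energy v n.
  rewrite /energy -meanD; apply: le_mean => I _; rewrite /bellman -[leRHS]mulr1.
  apply: ler_wpM2l; first by rewrite addr_ge0 ?sqr_ge0.
  by rewrite -expR0 ler_expR oppr_le0 divr_ge0 ?(ltW C0)//; have /andP[] := AC I.
have := le_trans ge le; rewrite expRN -invfM mulrC ler_pdivrMr ?mulr_gt0 ?expR_gt0//.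
by rewrite mulrC.
Qed.

(** When C = 0 the potential, hence the sequence, vanishes; otherwise the
    partial sums over levels are controlled by [carleson_sum_le]. *)
Lemma carleson_embedding (C : R) (w : D4 -> R) :
  (forall I, 0 <= w I) -> balanced w -> packing w C ->
  forall u v, hardy u v ->
  ((\esum_(I in [set: D4]) (w I * (u I ^+ 2 + v I ^+ 2))%:E)
    <= (expR 1 * C)%:E * hardy_norm_sq u v)%E.
Proof.
move=> w0 bal pack u v h.
pose g I := (w I)%:E.
have g0 I : (0 <= g I)%E by rewrite lee_fin.
have lenV I : (0 <= (len R I)^-1%:E)%E by rewrite lee_fin invr_ge0 ltW// len_gt0.
have ge0 I : (0 <= (len R I)^-1%:E * mass g I)%E by rewrite mule_ge0// mass_ge0.
have C0 : 0 <= C.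
  by have := le_trans (ge0 (@cell 0 ord0)) (pack _); rewrite lee_fin.
have fin I : mass g I \is a fin_num.
  rewrite ge0_fin_numE; last exact: mass_ge0.
  have := pack I; rewrite -/(mass g I).
  rewrite -[(len R I)^-1%:E]/((len R I)^-1)%:E lee_pdivrMl ?len_gt0// -EFinM => le.
  exact: le_lt_trans le (ltry _).
pose A I := fine (mass g I) / len R I.
pose m I := w I / len R I.
have massE I : mass g I = (A I * len R I)%:E.
  by rewrite /A divfK ?gt_eqF ?len_gt0// fineK.
have pot : carleson_potential A m.
  move=> I s; have := bal I s; rewrite esum_half// -/(mass g I) !massE.
  rewrite -EFinD -!EFinM -EFinB => -[] e.
  move: e; rewrite !len_child; set l := len R I.
  have ln : l != 0 by rewrite gt_eqF ?len_gt0.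
  have -> : (l / 2)^-1 * (A (child s true I) * (l / 4) + A (child s false I) * (l / 4)) =
    (A (child s true I) + A (child s false I)) / 2 by field.
  by rewrite [l^-1 * _]mulrC mulfK// /m -/l => ->; rewrite addrC subrK.
have m0 I : 0 <= m I by apply: divr_ge0 => //; rewrite ltW// len_gt0.
have AC I : 0 <= A I <= C.
  apply/andP; split; first by rewrite divr_ge0 ?fine_ge0 ?mass_ge0// ltW// len_gt0.
  have := pack I; rewrite -/(mass g I) massE -EFinM lee_fin.
  by rewrite mulrC mulfK// gt_eqF ?len_gt0.
have [[martu _] [martv _] cr] := h.
have wE I : w I = len R I * m I by rewrite /m mulrC divfK// gt_eqF ?len_gt0.
move: C0; rewrite le_eqVlt => /orP[/eqP C0|C0].
  have mz I : m I = 0.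
    apply/eqP; rewrite eq_le m0 andbT.
    have := pot I Sx; have := AC I; have := AC (child Sx true I).
    by have := AC (child Sx false I); rewrite -C0; lra.
  rewrite -C0 mulr0 mul0e esum1// => I _.
  by rewrite wE mz mulr0 mul0r.
rewrite esum_D4; last first.
  by move=> I; rewrite lee_fin mulr_ge0 ?addr_ge0 ?sqr_ge0.
apply: lime_le.
  apply: is_cvg_nneseries => k _ _; apply: sume_ge0 => i _.
  by rewrite lee_fin mulr_ge0 ?addr_ge0 ?sqr_ge0.
apply: nearW => n.
apply: (@le_trans _ _ ((expR 1 * C)%:E * (energy u n + energy v n)%:E)%E); last first.
  by rewrite lee_pmul2l ?lte_fin ?mulr_gt0 ?expR_gt0// energy_le_hardy_norm_sq.
rewrite -EFinM; apply: le_trans (_ : _ <= (\sum_(0 <= k < n)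
   mean (fun I => m I * (u I ^+ 2 + v I ^+ 2)) k)%:E)%E _; last first.
  by rewrite lee_fin; exact: carleson_sum_le AC pot.
rewrite -sumEFin; apply: lee_sum => k _; rewrite sumEFin lee_fin.
by rewrite /mean; apply: ler_sum => i _; rewrite wE mulrA.
Qed.

End Embedding.

(** * Families defined by recursion along the tree *)

Section Tree.
Variables (T : Type) (x0 : T) (next : nat -> T -> slice -> bool -> T).

(** The last base-4 digit of the index tells which child of its parent an
    interval is: its upper bit selects the slice and its lower bit the half. *)
Fixpoint tree_nat (k n : nat) : T :=
  if k is k'.+1 then
    next k' (tree_nat k' (n %/ 4)) (if odd n./2 then Sx else Sy) (odd n)
  else x0.

Definition tree (I : D4) : T := tree_nat (projT1 I) (projT2 I).

Lemma tree_child s b I : tree (child s b I) = next (projT1 I) (tree I) s b.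
Proof.
rewrite /tree /=; move: (projT2 I : nat) => n; congr next.
- by congr tree_nat; case: s; case: b => /=; lia.
- have -> : odd (4 * n + 2 * is_x s + b)./2 = is_x s by case: s; case: b => /=; lia.
  by case: s.
- by case: s; case: b => /=; lia.
Qed.

Lemma tree_ind (P : T -> Prop) :
  P x0 -> (forall k x s b, P x -> P (next k x s b)) -> forall I, P (tree I).
Proof.
move=> P0 Pn [k [n ltn]]; rewrite /tree /= {ltn}.
by elim: k n => [|k IH] n //=; exact: Pn.
Qed.

End Tree.

(** * Balanced sequences from a potential *)

Section Potential.
Variables (R : realType) (A m : D4 -> R) (N : nat).
Hypothesis m0 : forall I, 0 <= m I.
Hypothesis pot : carleson_potential A m.
Hypothesis vanish : forall I, (N < projT1 I)%N -> A I = 0.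

Let w I := len R I * m I.

Lemma potential_weight_ge0 I : 0 <= w I.
Proof. by rewrite mulr_ge0// ltW// len_gt0. Qed.

(** A potential that vanishes below level N is the normalized mass of its own
    defect, by induction from level N upwards. *)
Lemma mass_potential I : mass (fun J => (w J)%:E) I = (len R I * A I)%:E.
Proof.
have w0 J : (0 <= (w J)%:E)%E by rewrite lee_fin potential_weight_ge0.
have [k] := ubnP (N.+1 - projT1 I); elim: k I => // k IH I le.
have [lt|ge] := ltnP N (projT1 I).
  rewrite vanish// mulr0 /mass esum1// => J /itv4_sub_level IJ.
  have mJ : m J = 0.
    have := pot J Sx; rewrite !vanish/=; [|lia..].
    by rewrite addr0 mul0r addr0 => <-.
  by rewrite /w mJ mulr0.
rewrite mass_children// !IH/=; try lia.
rewrite -!EFinD !len_child /w; congr (_%:E).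
have -> : A I = m I + (A (child Sx true I) + A (child Sx false I) +
    (A (child Sy true I) + A (child Sy false I))) / 4.
  by have := pot I Sx; have := pot I Sy; lra.
by field.
Qed.

Lemma balanced_potential : balanced w.
Proof.
move=> I s; rewrite esum_half; last by move=> J; rewrite lee_fin potential_weight_ge0.
rewrite -/(mass (fun J => (w J)%:E) I) !mass_potential.
have ln : len R I != 0 by rewrite gt_eqF ?len_gt0.
rewrite -EFinD -!EFinM -EFinB; congr (_%:E).
by rewrite !len_child /w (pot I s); field.
Qed.

Lemma packing_potential C : (forall I, A I <= C) -> packing w C.
Proof.
move=> AC I; rewrite -/(mass (fun J => (w J)%:E) I) mass_potential -EFinM lee_fin.
by rewrite mulKf ?gt_eqF ?len_gt0.
Qed.

End Potential.

(** * A multiplicative martingale driven by a random walk *)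

Section Walk.
Variables (R : realType) (N n : nat).
Hypothesis N2 : (2 <= N)%N.

(* x ^+ j is exp (j / N), and t is tanh (1 / (2 N)), the step for which
   multiplying f by 1 + t while the potential rises by 1 / N changes
   |f|^2 exp (- A) by the same factor as multiplying f by 1 - t while the
   potential falls by 1 / N. *)
Let x : R := expR N%:R^-1.
Let t : R := (x - 1) / (x + 1).

(** The position of the walk once the mass at the top has been removed. *)
Definition low j := if j == N then N.-1 else j.

Lemma low_pos j : (0 < j)%N -> exists2 l, low j = l.+1 & j = ((j == N) + l.+1)%N.
Proof.
by move=> j0; exists (low j).-1; rewrite /low; case: eqP => /=; lia.
Qed.

Definition active k j := (k < n)%N && (0 < j)%N.

Definition speed k j : R := if active k j then t else 0.

(** In slice x the modulus of f changes by the factor 1 +- t and the potential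
    by +-1/N; in slice y the Cauchy-Riemann equations force the factor 1 +- it,
    and the potential stays put.  After level n, or once the walk is absorbed
    at 0, nothing moves. *)
Definition walk_next k (z : R * R * nat) s b : R * R * nat :=
  let: (u, v, j) := z in
  let p := speed k j * u in let q := speed k j * v in
  let i := if active k j then low j else j in
  match s, b with
  | Sx, true => (u + p, v + q, if active k j then i.+1 else j)
  | Sx, false => (u - p, v - q, if active k j then i.-1 else j)
  | Sy, true => (u - q, v + p, i)
  | Sy, false => (u + q, v - p, i)
  end.

Definition walk := tree ((1, 0), N) walk_next.
Definition wu I := (walk I).1.1.
Definition wv I := (walk I).1.2.
Definition wj I := (walk I).2.

Lemma walk_child s b I : walk (child s b I) = walk_next (projT1 I) (walk I) s b.
Proof. exact: tree_child. Qed.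

Lemma walk_child_uv s b I : (walk (child s b I)).1 =
  let p := speed (projT1 I) (wj I) * wu I in let q := speed (projT1 I) (wj I) * wv I in
  match s, b with
  | Sx, true => (wu I + p, wv I + q)
  | Sx, false => (wu I - p, wv I - q)
  | Sy, true => (wu I - q, wv I + p)
  | Sy, false => (wu I + q, wv I - p)
  end.
Proof. by rewrite walk_child /wu /wv /wj; case: (walk I) => -[u v] j; case: s; case: b. Qed.

Lemma wj_child s b I : wj (child s b I) =
  if active (projT1 I) (wj I) then
    match s, b with
    | Sx, true => (low (wj I)).+1
    | Sx, false => (low (wj I)).-1
    | _, _ => low (wj I)
    end
  else wj I.
Proof.
rewrite /wj walk_child; case: (walk I) => -[u v] j /=.
by case: s; case: b => //=; case: active.
Qed.

Lemma wj_le I : (wj I <= N)%N.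
Proof.
apply: (@tree_ind _ _ _ (fun z => z.2 <= N)%N) => // k [[u v] j] s b /= jN.
by case: s; case: b; rewrite /= /low; case: active => //; case: eqP; lia.
Qed.

Lemma walk_martingale_u : sliced_martingale wu.
Proof. by move=> I; rewrite /wu !walk_child_uv /=; split; field. Qed.

Lemma walk_martingale_v : sliced_martingale wv.
Proof. by move=> I; rewrite /wv !walk_child_uv /=; split; field. Qed.

Lemma walk_cauchy_riemann : cauchy_riemann wu wv.
Proof. by move=> I; rewrite /Delta /wu /wv !walk_child_uv /=; split; field. Qed.

Definition walk_A I : R := if (projT1 I <= n)%N then (wj I)%:R / N%:R else 0.
(** At level n the whole remaining potential is spent, so that the potential
    vanishes further down. *)
Definition walk_m I : R := if (projT1 I < n)%N then (wj I == N)%:R / N%:R else walk_A I.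

Lemma walk_A_ge0 I : 0 <= walk_A I.
Proof. by rewrite /walk_A; case: ifP => // _; rewrite divr_ge0. Qed.

Lemma N_gt0 : 0 < N%:R :> R.
Proof. by rewrite ltr0n; lia. Qed.

Lemma walk_A_le1 I : walk_A I <= 1.
Proof.
rewrite /walk_A; case: ifP => // _.
by rewrite ler_pdivrMr ?N_gt0// mul1r ler_nat wj_le.
Qed.

Lemma walk_m_ge0 I : 0 <= walk_m I.
Proof. by rewrite /walk_m; case: ifP => // _; rewrite ?divr_ge0 ?walk_A_ge0. Qed.

Lemma walk_potential : carleson_potential walk_A walk_m.
Proof.
have Nn : N%:R != 0 :> R by rewrite gt_eqF ?N_gt0.
move=> I s; rewrite /walk_m /walk_A /= !wj_child /active.
case: (ltnP (projT1 I) n) => h /=; last first.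
  by rewrite addr0 mul0r addr0.
rewrite (ltnW h); case: posnP => [->|j0].
  by rewrite (_ : (0 == N)%N = false)/=; [field|lia].
have [l -> /(congr1 (fun i : nat => i%:R : R))] := low_pos j0.
rewrite natrD => ->; rewrite -(natr1 l) -?natr1.
by case: s; rewrite /= -?natr1; field.
Qed.

Lemma x_gt1 : 1 < x.
Proof. by rewrite /x expR_gt1 invr_gt0 N_gt0. Qed.

Lemma x_gt0 : 0 < x.
Proof. exact: expR_gt0. Qed.

Lemma xN : x ^+ N = expR 1.
Proof. by rewrite /x -expRM_natl mulfV// gt_eqF ?N_gt0. Qed.

(** This is exp (- 1 / N) > 1 - 1 / N: the mass that a visit at the top creates is
    slightly too small to make up for the probability 1 / N of absorption before
    the next visit. *)
Lemma x_slack : x * (N%:R - 1) < N%:R.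
Proof.
have Nn := N_gt0; have inn : - N%:R^-1 != 0 :> R by rewrite oppr_eq0 invr_eq0 gt_eqF.
have := expR_gt1Dx inn; rewrite expRN -/x => h.
rewrite -ltr_pdivlMl ?x_gt0// -(ltr_pM2r (x := N%:R^-1)) ?invr_gt0//.
by rewrite mulfK ?gt_eqF// mulrBl mulfV ?gt_eqF// mul1r.
Qed.

(** The function |f|^2 exp (- A), whose average changes only at the top. *)
Definition density I : R := (wu I ^+ 2 + wv I ^+ 2) / x ^+ wj I.

Lemma density_ge0 I : 0 <= density I.
Proof. by rewrite divr_ge0 ?addr_ge0 ?sqr_ge0 ?exprn_ge0// ltW// x_gt0. Qed.

(** The transition operator of the walk under the density |f|^2 exp (- A):
    a lazy symmetric walk on the interior, with creation of mass at the top. *)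
Definition transition (g : nat -> R) j : R :=
  if j == 0%N then g 0%N else
  (if j == N then x else 1) *
  ((1 - t ^+ 2) / 4 * (g (low j).+1 + g (low j).-1) + (1 + t ^+ 2) / 2 * g (low j)).

Lemma avg4_density g I : (projT1 I < n)%N ->
  avg4 (fun J => density J * g (wj J)) I = density I * transition g (wj I).
Proof.
move=> In; have x0 := x_gt0; have x1 := x_gt1.
have xn : x != 0 by rewrite gt_eqF.
have x1n : x + 1 != 0 by rewrite gt_eqF// addr_gt0.
rewrite /avg4 /density /transition /wu /wv !walk_child_uv /= !wj_child /speed /active In /=.
case: posnP => [->|j0].
  by rewrite !mul0r !subr0 !addr0; field; rewrite ?expf_neq0.
have [l -> jE] := low_pos j0.
have -> : x ^+ wj I = (if wj I == N then x else 1) * x ^+ l.+1.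
  by rewrite {1}jE; case: eqP; rewrite ?mul1r// exprS.
have pn : x ^+ l != 0 by rewrite expf_neq0.
have -> : (wu I ^+ 2 + wv I ^+ 2) / ((if wj I == N then x else 1) * x ^+ l.+1) *
  ((if wj I == N then x else 1) *
   ((1 - t ^+ 2) / 4 * (g l.+2 + g l.+1.-1) + (1 + t ^+ 2) / 2 * g l.+1)) =
  (wu I ^+ 2 + wv I ^+ 2) / x ^+ l.+1 *
  ((1 - t ^+ 2) / 4 * (g l.+2 + g l) + (1 + t ^+ 2) / 2 * g l.+1).
  by case: eqP => _; rewrite !exprS /=; field; rewrite ?pn ?xn.
by rewrite /wu /wv !exprS /t; field; rewrite pn xn x1n.
Qed.

Definition total (g : nat -> R) k : R := mean (fun I => density I * g (wj I)) k.

Lemma totalS g k : (k < n)%N -> total g k.+1 = total (transition g) k.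
Proof. by move=> kn; rewrite /total meanS; apply: eq_mean => I Ik; rewrite avg4_density// Ik. Qed.

Lemma le_total g h k : (forall j, (j <= N)%N -> g j <= h j) -> total g k <= total h k.
Proof.
move=> gh; apply: le_mean => I _; apply: ler_wpM2l; first exact: density_ge0.
exact/gh/wj_le.
Qed.

Lemma totalD g h k : total (fun j => g j + h j) k = total g k + total h k.
Proof. by rewrite /total -meanD; apply: eq_mean => I _; rewrite mulrDr. Qed.

Lemma totalZ a g k : total (fun j => a * g j) k = a * total g k.
Proof. by rewrite /total -meanZ; apply: eq_mean => I _; rewrite mulrCA. Qed.

Lemma total0 g : total g 0 = (expR 1)^-1 * g N.
Proof.
rewrite /total /mean big_ord1 /density /len expr0 invr1 mul1r.
have w0 (i : 'I_(4 ^ 0)%N) : walk (cell i) = (1, 0, N) by [].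
by rewrite /wu /wv /wj !w0 /= expr1n expr0n/= addr0 xN mul1r.
Qed.

Definition one (j : nat) : R := 1.
Definition at_top j : R := (j == N)%:R.
Definition alive j : R := (0 < j)%N%:R.

Lemma total_oneS k : (k < n)%N -> total one k.+1 = total one k + (x - 1) * total at_top k.
Proof.
move=> kn; rewrite totalS// -totalZ -totalD /total; apply: eq_mean => I _; congr (_ * _).
rewrite /transition /one /at_top; case: eqP => [->|_].
  by rewrite (_ : (0 == N)%N = false)/=; [ring|lia].
by case: eqP => _ /=; field.
Qed.

(** The function 1 + j is harmonic inside and, because
    exp (1 / N) >= 1 + 1 / N, subharmonic at the top.  As the starting
    point has height N and absorbed walkers have value 1, the total density
    has to grow by a factor of about N. *)
Lemma total_height : (N%:R + 1) / expR 1 <= total (fun j => 1 + j%:R) n.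
Proof.
have step k : (k <= n)%N -> (N%:R + 1) / expR 1 <= total (fun j => 1 + j%:R) k.
  elim: k => [|k IH] kn; first by rewrite total0 mulrC addrC.
  apply: le_trans (IH (ltnW kn)) _; rewrite totalS//; apply: le_total => j _.
  rewrite /transition; case: posnP => [->//|j0].
  have [l -> jE] := low_pos j0.
  have -> : (1 - t ^+ 2) / 4 * (1 + l.+2%:R + (1 + l.+1.-1%:R)) +
      (1 + t ^+ 2) / 2 * (1 + l.+1%:R) = 1 + l.+1%:R :> R.
    by rewrite -(natr1 l.+1) -(natr1 l) /=; field.
  rewrite {1}jE; case: eqP jE => [-> NE|_ _]; last by rewrite mul1r.
  have -> : 1 + l.+1%:R = N%:R :> R by rewrite nat1r NE.
  rewrite -NE.
  have le : 1 + N%:R^-1 <= x by exact: expR_ge1Dx.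
  apply: le_trans (_ : (1 + N%:R^-1) * N%:R <= _); last by rewrite ler_pM2r ?N_gt0.
  by rewrite mulrDl mul1r mulVf ?gt_eqF ?N_gt0// addrC.
exact: step.
Qed.

(* K is chosen so that the slack of the linear function at the top
   ([x_slack]) absorbs the mass created there from the quadratic term. *)
Let K : R := x * N%:R ^+ 2 / (N%:R - x * (N%:R - 1)).

(** A strictly superharmonic function: the concave quadratic term gives strict
    decrease inside, and a large multiple of the linear one gives it at the top. *)
Definition barrier (j : nat) : R := K * j%:R + j%:R * (2 * N%:R - j%:R).

Definition decay : R := 1 - (1 - t ^+ 2) / 2 / barrier N.

Lemma t_itv : 0 < t < 1.
Proof.
have x1 := x_gt1; rewrite /t; apply/andP; split.
  by rewrite divr_gt0// ?subr_gt0//; lra.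
by rewrite ltr_pdivrMr; lra.
Qed.

Lemma K_gt0 : 0 < K.
Proof.
by rewrite divr_gt0// ?subr_gt0 ?x_slack// mulr_gt0 ?x_gt0// exprn_gt0// N_gt0.
Qed.

Lemma barrierN_ge1 : 1 <= barrier N.
Proof.
rewrite /barrier; have K0 := K_gt0.
have N1 : 1 <= N%:R :> R by rewrite ler1n; lia.
have KN : 0 <= K * N%:R by rewrite mulr_ge0// ltW.
by nra.
Qed.

Lemma decay_itv : 0 <= decay < 1.
Proof.
have /andP[t0 t1] := t_itv; have h1 := barrierN_ge1.
have h0 : 0 < barrier N by lra.
have k0 : 0 < (1 - t ^+ 2) / 2 by rewrite divr_gt0// subr_gt0; nra.
have k1 : (1 - t ^+ 2) / 2 <= 1 by nra.
rewrite /decay; apply/andP; split.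
  by rewrite subr_ge0 ler_pdivrMr// mul1r; lra.
by rewrite gtrBl divr_gt0.
Qed.

Lemma barrier_le_top j : (j <= N)%N -> barrier j <= barrier N.
Proof.
rewrite -(ler_nat R) /barrier => jN; have K0 := K_gt0.
apply: lerD; first by rewrite ler_pM2l.
have := sqr_ge0 (N%:R - j%:R : R); nra.
Qed.

Lemma transition_barrier j : (j <= N)%N -> transition barrier j <= decay * barrier j.
Proof.
move=> jN; rewrite /transition; case: posnP => [->|j0].
  by rewrite /barrier mulr0 mul0r addr0 mulr0.
have /andP[t0 t1] := t_itv; have h1 := barrierN_ge1.
have h0 : 0 < barrier N by lra.
set kappa := (1 - t ^+ 2) / 2.
have k0 : 0 < kappa by rewrite divr_gt0// subr_gt0; nra.
have k1 : kappa <= 1 by rewrite /kappa; nra.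
have [l -> jE] := low_pos j0.
have -> : (1 - t ^+ 2) / 4 * (barrier l.+2 + barrier l.+1.-1) +
    (1 + t ^+ 2) / 2 * barrier l.+1 = barrier l.+1 - kappa.
  by rewrite /barrier /kappa -(natr1 l.+1) -(natr1 l) /=; field.
apply: (@le_trans _ _ (barrier j - kappa)); last first.
  rewrite /decay -/kappa mulrBl mul1r lerD2l lerN2 mulrAC ler_pdivrMr//.
  by rewrite ler_pM2l// barrier_le_top.
case: eqP jE => [->|_] /=; last by rewrite add0n mul1r => ->.
move=> NE.
have xg := x_gt0.
have -> : barrier l.+1 = K * (N%:R - 1) + N%:R ^+ 2 - 1.
  rewrite /barrier (_ : l.+1%:R = N%:R - 1) //; last first.
    by rewrite NE add1n -(natr1 l.+1) addrK.
  by ring.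
have sl := x_slack.
have KE : x * (K * (N%:R - 1)) = K * N%:R - x * N%:R ^+ 2.
  by rewrite /K; field; rewrite subr_eq0 gt_eqF.
have -> : barrier N = K * N%:R + N%:R ^+ 2 by rewrite /barrier; ring.
have N1 : 1 <= N%:R :> R by rewrite ler1n; lia.
have -> : x * (K * (N%:R - 1) + N%:R ^+ 2 - 1 - kappa) = K * N%:R - x * (1 + kappa).
  by rewrite -addrA -addrA mulrDr KE; ring.
have : 0 <= x * (1 + kappa) by rewrite mulr_ge0// ltW//; lra.
nra.
Qed.

(** The barrier is at least 1 on the walkers that are still alive, and its total
    is contracted at every level. *)
Lemma total_alive_le : total alive n <= decay ^+ n * (barrier N / expR 1).
Proof.
have /andP[d0 d1] := decay_itv; have K0 := K_gt0.
have step k : (k <= n)%N -> total barrier k <= decay ^+ k * (barrier N / expR 1).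
  elim: k => [|k IH] kn; first by rewrite total0 expr0 mul1r mulrC.
  rewrite totalS//; apply: le_trans (_ : decay * total barrier k <= _).
    by rewrite -totalZ; apply: le_total => j; exact: transition_barrier.
  by rewrite exprS -mulrA ler_wpM2l// IH// ltnW.
apply: le_trans (step n (leqnn n)); apply: le_total => j jN; rewrite /alive /barrier.
case: posnP => [->|j0]; first by rewrite mulr0 mul0r addr0.
have j1 : 1 <= j%:R :> R by rewrite ler1n.
have jN' : j%:R <= N%:R :> R by rewrite ler_nat.
have Kj : 0 <= K * j%:R by rewrite mulr_ge0// ltW.
have jNj : 1 <= j%:R * (2 * N%:R - j%:R) :> R by nra.
by rewrite (le_trans jNj)// lerDr.
Qed.

Lemma walk_energy_stationary k : (n <= k)%N ->
  energy wu k = energy wu n /\ energy wv k = energy wv n.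
Proof.
elim: k => [|k IH]; first by rewrite leqn0 => /eqP ->.
rewrite leq_eqVlt => /orP[/eqP ->//|nk].
have [<- <-] := IH nk.
rewrite /energy !meanS; split; apply: eq_mean => I Ik;
  rewrite /avg4 /wu /wv !walk_child_uv /= /speed /active Ik ltnNge -ltnS nk /=
    !mul0r !subr0 !addr0;
  by field.
Qed.

Lemma walk_hardy : hardy wu wv.
Proof.
have H u : sliced_martingale u ->
    (forall k, (n <= k)%N -> energy u k = energy u n) -> L2_integrable u.
  move=> mart stationary; exists (energy u n) => k; change (energy u k <= energy u n).
  by case: (leqP k n) => [kn|/ltnW nk]; [exact: energy_homo|rewrite (stationary k)].
split; last exact: walk_cauchy_riemann.
- split; first exact: walk_martingale_u.
  by apply: H => [|k nk]; [exact: walk_martingale_u|have [] := walk_energy_stationary nk].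
- split; first exact: walk_martingale_v.
  by apply: H => [|k nk]; [exact: walk_martingale_v|have [] := walk_energy_stationary nk].
Qed.

Lemma walk_hardy_norm_sq : hardy_norm_sq wu wv = (energy wu n + energy wv n)%:E.
Proof.
have [b -> cb] := hardy_norm_sqE walk_hardy; congr (_%:E).
rewrite -(cvg_lim _ cb)//; apply: cvg_lim => //; apply: cvg_near_cst.
by exists n => // k /= nk; have [-> ->] := walk_energy_stationary nk.
Qed.

(** On absorbed intervals the density is |f|^2 itself; elsewhere it is smaller by
    a factor of at most e. *)
Lemma walk_norm_le : energy wu n + energy wv n <= total one n + expR 1 * total alive n.
Proof.
rewrite /energy -meanD -totalZ -totalD; apply: le_mean => I _.
have -> : wu I ^+ 2 + wv I ^+ 2 = density I * x ^+ wj I.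
  by rewrite /density divfK// expf_neq0// gt_eqF// x_gt0.
apply: ler_wpM2l; first exact: density_ge0.
rewrite /one /alive; case: posnP => [->|j0]; first by rewrite expr0 mulr0 addr0.
rewrite mulr1 -xN; apply: (@le_trans _ _ (x ^+ N)); last by rewrite lerDr.
by rewrite ler_eXn2l ?x_gt1// wj_le.
Qed.

(** Density is created only at the top, by the amount x - 1 per unit, while
    mu |f|^2 receives e / N per unit there. *)
Lemma walk_carleson_sum :
  (x - 1) * \sum_(0 <= k < n) mean (fun I => walk_m I * (wu I ^+ 2 + wv I ^+ 2)) k =
  expR 1 / N%:R * (total one n - (expR 1)^-1).
Proof.
have step k : (k <= n)%N ->
    (x - 1) * \sum_(0 <= i < k) mean (fun I => walk_m I * (wu I ^+ 2 + wv I ^+ 2)) i =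
    expR 1 / N%:R * (total one k - (expR 1)^-1).
  elim: k => [|k IH] kn; first by rewrite big_nil mulr0 total0 /one mulr1 subrr mulr0.
  rewrite big_nat_recr//= mulrDr IH ?(ltnW kn)// total_oneS//.
  have -> : mean (fun I => walk_m I * (wu I ^+ 2 + wv I ^+ 2)) k =
      expR 1 / N%:R * total at_top k.
    rewrite /total -meanZ; apply: eq_mean => I Ik.
    rewrite /walk_m Ik kn /at_top /density; case: eqP => [->|_]; last by rewrite !mul0r !mulr0.
    by rewrite xN; field; rewrite gt_eqF ?expR_gt0// gt_eqF ?N_gt0.
  by ring.
exact: step.
Qed.

Lemma total_one_ge : (N%:R + 1) / expR 1 - N%:R * total alive n <= total one n.
Proof.
rewrite lerBlDr; apply: le_trans total_height _; rewrite -totalZ -totalD.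
apply: le_total => j jN; rewrite /one lerD2l /alive.
by case: posnP => [->|_] /=; rewrite ?mulr0// mulr1 ler_nat.
Qed.

(** The first hypothesis says that few walkers are alive at level n, the second
    that N is large in terms of e - c.  Up to factors 1 + O(1/N) the Carleson sum
    is then e times the total density, and the norm is the total density. *)
Lemma walk_ratio (c : R) : 0 <= c ->
  N%:R * total alive n <= (expR 1)^-1 ->
  2 * expR 1 + c * expR 1 < N%:R * (expR 1 - c) ->
  c * (energy wu n + energy wv n) <
    \sum_(0 <= k < n) mean (fun I => walk_m I * (wu I ^+ 2 + wv I ^+ 2)) k.
Proof.
move=> c0 qle Nbig.
have q0 : 0 <= total alive n.
  by apply: mean_ge0 => I; rewrite mulr_ge0 ?density_ge0// /alive ler0n.
have := walk_carleson_sum; have := walk_norm_le; have := total_one_ge.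
move: qle q0; move: (total one n) (total alive n) => P q.
set S := \sum_(_ <= _ < _) _; move: S (energy wu n + _) => S E.
have := x_slack; have := x_gt1; have N1 : 1 < N%:R :> R by rewrite ltr1n.
have := expR_gt0 (1 : R); move: Nbig N1.
move: (expR 1) (N%:R : R) x => e M y.
move=> Mbig M1 e0 y1 ysl qle q0 Pge Ele SE.
have ei : e * e^-1 = 1 by rewrite mulfV// gt_eqF.
have ei0 : 0 < e^-1 by rewrite invr_gt0.
move: ei ei0 qle Pge SE; move: e^-1 => p ep p0 qle Pge SE.
have M0 : 0 < M by lra.
have MpP : M * p <= P.
  by move: Pge; rewrite mulrDl mul1r; lra.
have {}SE : (y - 1) * M * S = e * (P - p).
  by rewrite -mulrA (mulrC M) mulrA SE; field; rewrite gt_eqF.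
have P0 : 0 < P by apply: lt_le_trans MpP; rewrite mulr_gt0.
have Pp : 0 < P - p.
  rewrite subr_gt0; apply: lt_le_trans MpP.
  by rewrite -subr_gt0 -{2}(mul1r p) -mulrBl mulr_gt0// subr_gt0.
have yM0 : 0 < (y - 1) * M by rewrite mulr_gt0// subr_gt0.
have S0 : 0 < S by rewrite -(pmulr_rgt0 _ yM0) SE mulr_gt0.
have MM0 : 0 < M ^+ 2 by rewrite exprn_gt0.
(* One factor M - 1 is the starting value lost from P - p, the other comes from
   (y - 1) * (M - 1) < 1, that is from exp (1 / N) - 1 < 1 / (N - 1). *)
have lower : e * P * (M - 1) ^+ 2 < M ^+ 2 * S.
  have h : e * P * (M - 1) <= (y - 1) * M ^+ 2 * S.
    have -> : (y - 1) * M ^+ 2 * S = e * (M * (P - p)).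
      by rewrite (_ : _ * S = M * ((y - 1) * M * S)); [rewrite SE; ring|ring].
    by rewrite -mulrA ler_pM2l//; lra.
  apply: (@le_lt_trans _ _ ((y - 1) * M ^+ 2 * S * (M - 1))).
    by rewrite expr2 mulrA ler_wpM2r// subr_ge0 ltW.
  have -> : (y - 1) * M ^+ 2 * S * (M - 1) = (y - 1) * (M - 1) * (M ^+ 2 * S) by ring.
  by rewrite gtr_pMl ?mulr_gt0//; lra.
have upper : M ^+ 2 * (c * E) <= c * P * (M ^+ 2 + e).
  have Mq : M ^+ 2 * q <= P.
    by apply: le_trans MpP; rewrite expr2 -mulrA ler_pM2l.
  apply: (@le_trans _ _ (c * (M ^+ 2 * (P + e * q)))).
    by rewrite mulrCA ler_wpM2l// ler_pM2l.
  rewrite -[leRHS]mulrA ler_wpM2l//.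
  have : e * (M ^+ 2 * q) <= e * P by rewrite ler_pM2l.
  lra.
rewrite -(ltr_pM2l MM0); apply: le_lt_trans upper (le_lt_trans _ lower).
have -> : c * P * (M ^+ 2 + e) = P * (c * (M ^+ 2 + e)) by ring.
have -> : e * P * (M - 1) ^+ 2 = P * (e * (M - 1) ^+ 2) by ring.
rewrite ler_pM2l//.
have ce0 : 0 <= c * e by rewrite mulr_ge0// ltW.
have h1 : M * (2 * e + c * e) <= M * (M * (e - c)) by rewrite ler_pM2l// ltW.
have h2 : 0 <= (M - 1) * (c * e) by rewrite mulr_ge0// subr_ge0 ltW.
lra.
Qed.

End Walk.

(** * Sharpness of the constant *)

Section Sharpness.
Variable R : realType.

(** First N is chosen from c, then n from N.  A negative c is replaced by 0. *)
Lemma carleson_embedding_sharp (c : R) : c < expR 1 ->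
  exists (w : D4 -> R) (C : R) (u v : D4 -> R),
   [/\ forall I : D4, 0 <= w I, balanced w, packing w C, hardy u v &
     ((c * C)%:E * hardy_norm_sq u v
        < (\esum_(I in [set: D4]) (w I * (u I ^+ 2 + v I ^+ 2))%:E))%E].
Proof.
move=> ce; pose c' := Num.max c 0.
have c'0 : 0 <= c' by rewrite le_max lexx orbT.
have c'e : c' < expR 1 by rewrite gt_max ce expR_gt0.
pose X := (2 * expR 1 + c' * expR 1) / (expR 1 - c').
pose N := (Num.truncn X).+2.
have N2 : (2 <= N)%N by [].
have Nbig : 2 * expR 1 + c' * expR 1 < N%:R * (expR 1 - c').
  rewrite -ltr_pdivrMr ?subr_gt0// -/X.
  have X0 : 0 <= X.
    by apply: divr_ge0; [rewrite addr_ge0 ?mulr_ge0 ?expR_ge0|rewrite subr_ge0 ltW].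
  have /andP[_ /lt_trans] := truncn_itv X0; apply.
  by rewrite ltr_nat.
have [n small] : exists n, N%:R * total N n (@alive R) n <= (expR 1)^-1 :> R.
  have /andP[d0 d1] := decay_itv R N2.
  have := cvg_geometric (barrier R N N / expR 1 * N%:R) (_ : `|decay R N| < 1).
  rewrite ger0_norm// => /(_ d1) /cvgrPdist_le /(_ (expR 1)^-1).
  rewrite invr_gt0 expR_gt0 => /(_ isT)[n _ /(_ n (leqnn n))].
  rewrite sub0r normrN /geometric /= => le; exists n.
  apply: le_trans (le_trans (ler_norm _) le).
  have := total_alive_le R n N2; rewrite -(ler_pM2l (N_gt0 R N2)) => /le_trans; apply.
  by rewrite le_eqVlt; apply/orP; left; apply/eqP; ring.
pose w I := len R I * walk_m R N n I.
have m0 := walk_m_ge0 R N n.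
have w0 I : 0 <= w I by rewrite mulr_ge0 ?m0// ltW// len_gt0.
have pot := walk_potential R n N2.
have vanish I : (n < projT1 I)%N -> walk_A R N n I = 0.
  by rewrite /walk_A ltnNge => /negbTE ->.
exists w, 1, (wu R N n), (wv R N n); split=> //.
- exact: balanced_potential pot vanish.
- apply: (packing_potential m0 pot vanish) => I; exact: walk_A_le1.
- exact: walk_hardy.
rewrite walk_hardy_norm_sq// mulr1 -EFinM esum_D4; last first.
  by move=> I; rewrite lee_fin mulr_ge0 ?addr_ge0 ?sqr_ge0.
apply: (@lt_le_trans _ _ (\sum_(0 <= k < n) \sum_(i < (4 ^ k)%N)
   (w (cell i) * (wu R N n (cell i) ^+ 2 + wv R N n (cell i) ^+ 2))%:E)%E); last first.
  apply: nneseries_lim_ge => k _ _; apply: sume_ge0 => i _.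
  by rewrite lee_fin mulr_ge0 ?addr_ge0 ?sqr_ge0.
under eq_bigr do rewrite sumEFin.
rewrite sumEFin lte_fin.
apply: le_lt_trans (_ : _ <= c' * (energy (wu R N n) n + energy (wv R N n) n)) _.
  rewrite ler_wpM2r ?le_max ?lexx// addr_ge0//; apply: mean_ge0 => I; exact: sqr_ge0.
have := walk_ratio N2 c'0 small Nbig.
rewrite (_ : \sum_(_ <= _ < _) _ = \sum_(0 <= k < n) \sum_(i < (4 ^ k)%N)
   (w (cell i) * (wu R N n (cell i) ^+ 2 + wv R N n (cell i) ^+ 2)))//.
apply: eq_bigr => k _; rewrite /mean; apply: eq_bigr => i _.
by rewrite /w mulrA.
Qed.

End Sharpness.

Theorem theorem4 (R : realType) :
  (forall (mu : D4 -> R) (C : R),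
     (forall I : D4, 0 <= mu I) -> balanced mu -> packing mu C ->
     forall u v : D4 -> R, hardy u v ->
       ((\esum_(I in [set: D4]) (mu I * (u I ^+ 2 + v I ^+ 2))%:E)
          <= (expR 1 * C)%:E * hardy_norm_sq u v)%E) /\
  (forall c : R, c < expR 1 ->
     exists (mu : D4 -> R) (C : R) (u v : D4 -> R),
       [/\ forall I : D4, 0 <= mu I, balanced mu, packing mu C, hardy u v &
         ((c * C)%:E * hardy_norm_sq u v
            < (\esum_(I in [set: D4]) (mu I * (u I ^+ 2 + v I ^+ 2))%:E))%E]).
Proof.
split=> [w C w0 bal pack u v h|c ce]; first exact: carleson_embedding.
exact: carleson_embedding_sharp.
Qed.
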